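(* Assume the setting described in the context and let $\theta=(\theta_1,\dots,\theta_{\mathfrak d})\in\mathbb R^{\mathfrak d}$. Write $x=(x_1,\dots,x_{\ell_0})$ for points of $[a,b]^{\ell_0}$, let empty products equal $1$, and for $k\in\{1,\dots,L\}$ let $\sum_{v_k,\dots,v_L}$ denote the sum over all $(v_k,v_{k+1},\dots,v_L)\in\mathbb N^{L-k+1}$ with $v_w\le\ell_w$ for all $w\in\{k,\dots,L\}$. Then (i) for all $r\in[1,\infty)$ it holds that $\mathcal L_r\in C^1(\mathbb R^{\mathfrak d},\mathbb R)$; (ii) for all $r\in[1,\infty)$, $k\in\{1,\dots,L\}$, $i\in\{1,\dots,\ell_k\}$, $j\in\{1,\dots,\ell_{k-1}\}$, $$\Big(\tfrac{\partial\mathcal L_r}{\partial\theta_{(i-1)\ell_{k-1}+j+\mathbf d_{k-1}}}\Big)(\theta)=\sum_{v_k,\dots,v_L}\int_{[a,b]^{\ell_0}}2\Big[\mathscr R_{r^{1/\max\{k-1,1\}}}(\mathcal N^{\max\{k-1,1\},\theta}_{r,j}(x))\mathbf 1_{(1,L]}(k)+x_j\mathbf 1_{\{1\}}(k)\Big]\mathbf 1_{\{i\}}(v_k)\Big[\mathcal N^{L,\theta}_{r,v_L}(x)-f_{v_L}(x)\Big]\prod_{n=k+1}^L\Big(\mathfrak w^{n,\theta}_{v_n,v_{n-1}}(\mathscr R_{r^{1/(n-1)}})'(\mathcal N^{n-1,\theta}_{r,v_{n-1}}(x))\Big)\,\mu(dx);$$ (iii) for all $r\in[1,\infty)$, $k\in\{1,\dots,L\}$,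 $i\in\{1,\dots,\ell_k\}$, $$\Big(\tfrac{\partial\mathcal L_r}{\partial\theta_{\ell_k\ell_{k-1}+i+\mathbf d_{k-1}}}\Big)(\theta)=\sum_{v_k,\dots,v_L}\int_{[a,b]^{\ell_0}}2\,\mathbf 1_{\{i\}}(v_k)\Big[\mathcal N^{L,\theta}_{r,v_L}(x)-f_{v_L}(x)\Big]\prod_{n=k+1}^L\Big(\mathfrak w^{n,\theta}_{v_n,v_{n-1}}(\mathscr R_{r^{1/(n-1)}})'(\mathcal N^{n-1,\theta}_{r,v_{n-1}}(x))\Big)\,\mu(dx);$$ (iv) $\limsup_{r\to\infty}\big(|\mathcal L_r(\theta)-\mathcal L_\infty(\theta)|+\|(\nabla\mathcal L_r)(\theta)-\mathcal G(\theta)\|\big)=0$; (v) for all $k\in\{1,\dots,L\}$, $i\in\{1,\dots,\ell_k\}$, $j\in\{1,\dots,\ell_{k-1}\}$, $$\mathcal G_{(i-1)\ell_{k-1}+j+\mathbf d_{k-1}}(\theta)=\sum_{v_k,\dots,v_L}\int_{[a,b]^{\ell_0}}2\Big[\mathscr R_\infty(\mathcal N^{\max\{k-1,1\},\theta}_{\infty,j}(x))\mathbf 1_{(1,L]}(k)+x_j\mathbf 1_{\{1\}}(k)\Big]\mathbf 1_{\{i\}}(v_k)\Big[\mathcal N^{L,\theta}_{\infty,v_L}(x)-f_{v_L}(x)\Big]\prod_{n=k+1}^L\Big(\mathfrak w^{n,\theta}_{v_n,v_{n-1}}\mathbf 1_{\mathcal X^{n-1,\theta}_{v_{n-1}}}(x)\Big)\,\mu(dx);$$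 (vi) for all $k\in\{1,\dots,L\}$, $i\in\{1,\dots,\ell_k\}$, $$\mathcal G_{\ell_k\ell_{k-1}+i+\mathbf d_{k-1}}(\theta)=\sum_{v_k,\dots,v_L}\int_{[a,b]^{\ell_0}}2\,\mathbf 1_{\{i\}}(v_k)\Big[\mathcal N^{L,\theta}_{\infty,v_L}(x)-f_{v_L}(x)\Big]\prod_{n=k+1}^L\Big(\mathfrak w^{n,\theta}_{v_n,v_{n-1}}\mathbf 1_{\mathcal X^{n-1,\theta}_{v_{n-1}}}(x)\Big)\,\mu(dx).$$
   Context: Setting. Let $L,\mathfrak d\in\mathbb N=\{1,2,\dots\}$, $(\ell_k)_{k\in\mathbb N_0}\subseteq\mathbb N$, $a\in\mathbb R$, $b\in(a,\infty)$, $\mathscr A\in(0,\infty)$, $\mathscr B\in(\mathscr A,\infty)$ with $\mathfrak d=\sum_{k=1}^L\ell_k(\ell_{k-1}+1)$; let $\mathbf a=\max\{|a|,|b|,1\}$ and $\mathbf d_k=\sum_{h=1}^k\ell_h(\ell_{h-1}+1)$ for $k\in\mathbb N_0$. For $\theta=(\theta_1,\dots,\theta_{\mathfrak d})\in\mathbb R^{\mathfrak d}$, $k\in\{1,\dots,L\}$, $i\in\{1,\dots,\ell_k\}$, $j\in\{1,\dots,\ell_{k-1}\}$ let $\mathfrak w^{k,\theta}_{i,j}=\theta_{(i-1)\ell_{k-1}+j+\mathbf d_{k-1}}$ and $\mathfrak b^{k,\theta}_i=\theta_{\ell_k\ell_{k-1}+i+\mathbf d_{k-1}}$, let $\mathfrak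 w^{k,\theta}=(\mathfrak w^{k,\theta}_{i,j})_{i,j}\in\mathbb R^{\ell_k\times\ell_{k-1}}$, $\mathfrak b^{k,\theta}=(\mathfrak b^{k,\theta}_1,\dots,\mathfrak b^{k,\theta}_{\ell_k})\in\mathbb R^{\ell_k}$, and $\mathcal A^\theta_k\colon\mathbb R^{\ell_{k-1}}\to\mathbb R^{\ell_k}$, $\mathcal A^\theta_k(x)=\mathfrak b^{k,\theta}+\mathfrak w^{k,\theta}x$. Let $\mathscr R_\infty(x)=\max\{x,0\}$ and let $\mathscr R_r\colon\mathbb R\to\mathbb R$, $r\in[1,\infty)$, satisfy for all $r\in[1,\infty)$: $\mathscr R_r\in C^1(\mathbb R,\mathbb R)$, $\mathscr R_r(x)=0$ for all $x\le\mathscr A r^{-1}$, $0\le\mathscr R_r(y)\le\max\{y,0\}$ for all $y\in\mathbb R$, $\mathscr R_r(z)=z$ for all $z\ge\mathscr B r^{-1}$; assume $\sup_{r\in[1,\infty)}\sup_{x\in\mathbb R}|(\mathscr R_r)'(x)|<\infty$. $\|\cdot\|$, $\langle\cdot,\cdot\rangle$ are the Euclidean norm and scalar product on each $\mathbb R^n$; for $r\in[1,\infty]$, $\mathfrak M_r(x_1,\dots,x_n)=(\mathscr R_r(x_1),\dots,\mathscr R_r(x_n))$. For $r\in[1,\infty]$, $\theta\in\mathbb R^{\mathfrak d}$ define $\mathcal N^{k,\theta}_r=(\mathcal N^{k,\theta}_{r,1},\dots,\mathcal N^{k,\theta}_{r,\ell_k})\colon\mathbb R^{\ell_0}\to\mathbb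 R^{\ell_k}$, $k\in\{1,\dots,L\}$, by $\mathcal N^{1,\theta}_r=\mathcal A^\theta_1$ and $\mathcal N^{k+1,\theta}_r(x)=\mathcal A^\theta_{k+1}(\mathfrak M_{r^{1/k}}(\mathcal N^{k,\theta}_r(x)))$ (with $\infty^{1/k}=\infty$), and let $\mathcal X^{k,\theta}_i=\{y\in[a,b]^{\ell_0}\colon\mathcal N^{k,\theta}_{\infty,i}(y)>0\}$. Let $\mu$ be a measure on the Borel $\sigma$-algebra of $[a,b]^{\ell_0}$ with $\mathfrak m=\mu([a,b]^{\ell_0})\in\mathbb R$, let $f=(f_1,\dots,f_{\ell_L})\colon[a,b]^{\ell_0}\to\mathbb R^{\ell_L}$ be measurable, and for $r\in[1,\infty]$ let $\mathcal L_r\colon\mathbb R^{\mathfrak d}\to\mathbb R$ be given by $\mathcal L_r(\theta)=\int_{[a,b]^{\ell_0}}\|\mathcal N^{L,\theta}_r(x)-f(x)\|^2\,\mu(dx)$ (these integrals are real numbers as part of the setting). Let $\mathcal G=(\mathcal G_1,\dots,\mathcal G_{\mathfrak d})\colon\mathbb R^{\mathfrak d}\to\mathbb R^{\mathfrak d}$ satisfy $\mathcal G(\theta)=\lim_{r\to\infty}(\nabla\mathcal L_r)(\theta)$ for every $\theta$ for which $((\nabla\mathcal L_r)(\theta))_{r\in[1,\infty)}$ is convergent as $r\to\infty$. *)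

(* Defs.v *)
From HB Require Import structures.
From mathcomp Require Import all_boot all_order all_algebra.
From mathcomp Require Import all_classical all_reals all_analysis.
Unset Printing Implicit Defensive.
Import Order.TTheory GRing.Theory Num.Theory.
Import numFieldNormedType.Exports.
Local Open Scope classical_set_scope.
Local Open Scope ring_scope.

(* 1-based coordinate access: ith v m = v_m for 1 <= m <= n, and 0 otherwise *)
Definition ith {R : nzRingType} {n : nat} (v : 'rV[R]_n) (m : nat) : R :=
  if m is m'.+1 then
    (match @insub _ (fun p => p < n)%N 'I_n m' with Some i => v 0 i | None => 0 end)
  else 0.

Definition dk (ell : nat -> nat) (k : nat) : nat :=
  (\sum_(1 <= h < k.+1) ell h * (ell h.-1 + 1))%N.

Definition wgt {R : nzRingType} {d : nat} (ell : nat -> nat) (theta : 'rV[R]_d)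
  (k i j : nat) : R :=
  ith theta ((i - 1) * ell (k - 1) + j + dk ell (k - 1))%N.

Definition bias {R : nzRingType} {d : nat} (ell : nat -> nat) (theta : 'rV[R]_d)
  (k i : nat) : R :=
  ith theta (ell k * ell (k - 1) + i + dk ell (k - 1))%N.

(* netN ell act theta x k i = i-th component N^{k,theta}_i (x) of the realization,
   where act m is the activation applied (componentwise) to the output of layer m:
   N^1 = A_1(x), N^{k+1} = A_{k+1}(act k (N^k)). *)
Fixpoint netN {R : nzRingType} {n0 d : nat} (ell : nat -> nat) (act : nat -> R -> R)
  (theta : 'rV[R]_d) (x : 'rV[R]_n0) (k i : nat) {struct k} : R :=
  match k with
  | 0 => 0
  | k'.+1 => bias ell theta k i +
      \sum_(j < ell k') wgt ell theta k i j.+1 *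
        (if k' is 0 then ith x j.+1 else act k' (netN ell act theta x k' j.+1))
  end.

Definition relu {R : realType} (x : R) : R := Num.max x 0.

Definition act_r {R : realType} (Rr : R -> R -> R) (r : R) : nat -> R -> R :=
  fun m => Rr (powR r (m%:R)^-1).

Definition act_inf {R : realType} : nat -> R -> R := fun _ => @relu R.

Definition BorelRV (R : realType) (n : nat) :=
  g_sigma_algebraType (@open 'rV[R]_n).

Definition box {R : realType} (n : nat) (a b : R) : set (BorelRV R n) :=
  [set x | forall i : 'I_n, a <= x 0 i <= b].

Definition sqerr {R : realType} {d : nat} (ell : nat -> nat) (L : nat)
  (act : nat -> R -> R) (theta : 'rV[R]_d)
  (f : BorelRV R (ell 0%N) -> 'rV[R]_(ell L)) (x : BorelRV R (ell 0%N)) : R :=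
  \sum_(i < ell L) (netN ell act theta x L i.+1 - ith (f x) i.+1) ^+ 2.

Definition loss {R : realType} {d : nat} (ell : nat -> nat) (L : nat)
  (mu : {measure set (BorelRV R (ell 0%N)) -> \bar R}) (a b : R)
  (act : nat -> R -> R) (f : BorelRV R (ell 0%N) -> 'rV[R]_(ell L))
  (theta : 'rV[R]_d) : R :=
  Rintegral mu (box (ell 0%N) a b) (sqerr ell L act theta f).

Definition ebasis {R : nzRingType} (d m : nat) : 'rV[R]_d :=
  \row_(p < d) (if p.+1 == m then 1 else 0).

Definition gradient {R : realType} {d : nat} (F : 'rV[R]_d -> R) (theta : 'rV[R]_d)
  : 'rV[R]_d :=
  \row_(p < d) derive F theta (ebasis d p.+1).

Definition C1 {R : realType} {d : nat} (F : 'rV[R]_d -> R) : Prop :=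
  (forall theta, differentiable F theta) /\ continuous (gradient F).

Definition enorm {R : realType} {d : nat} (v : 'rV[R]_d) : R :=
  Num.sqrt (\sum_(p < d) v 0 p ^+ 2).

(* sum over all (v_k, ..., v_L) with 1 <= v_w <= ell_w;
   cnt is the number of remaining indices, starting at index k *)
Fixpoint pathsum_aux {R : nzRingType} (ell : nat -> nat) (cnt k : nat)
  (F : (nat -> nat) -> R) {struct cnt} : R :=
  match cnt with
  | 0 => F (fun _ => 0%N)
  | c.+1 => \sum_(v < ell k)
      pathsum_aux ell c k.+1 (fun g => F (fun w => if w == k then v.+1 else g w))
  end.

Definition pathsum {R : nzRingType} (ell : nat -> nat) (k L : nat)
  (F : (nat -> nat) -> R) : R :=
  pathsum_aux ell (L.+1 - k) k F.

Definition ind {R : nzRingType} (c : bool) : R := if c then 1 else 0.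

Definition Xset {R : realType} {d : nat} (ell : nat -> nat) (a b : R)
  (theta : 'rV[R]_d) (n i : nat) : set (BorelRV R (ell 0%N)) :=
  [set y | box (ell 0%N) a b y /\ 0 < netN ell act_inf theta y n i].

Definition prod_r {R : realType} {d : nat} (ell : nat -> nat) (L : nat)
  (Rr : R -> R -> R) (r : R) (theta : 'rV[R]_d) (x : BorelRV R (ell 0%N))
  (v : nat -> nat) (k : nat) : R :=
  \prod_(k.+1 <= n < L.+1)
     (wgt ell theta n (v n) (v n.-1) *
      derive1 (Rr (powR r (n.-1)%:R^-1)) (netN ell (act_r Rr r) theta x n.-1 (v n.-1))).

Definition prod_inf {R : realType} {d : nat} (ell : nat -> nat) (L : nat) (a b : R)
  (theta : 'rV[R]_d) (x : BorelRV R (ell 0%N)) (v : nat -> nat) (k : nat) : R :=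
  \prod_(k.+1 <= n < L.+1)
     (wgt ell theta n (v n) (v n.-1) * (\1_(Xset ell a b theta n.-1 (v n.-1)) x : R)).

Definition rhsW_r {R : realType} {d : nat} (ell : nat -> nat) (L : nat)
  (mu : {measure set (BorelRV R (ell 0%N)) -> \bar R}) (a b : R)
  (Rr : R -> R -> R) (f : BorelRV R (ell 0%N) -> 'rV[R]_(ell L))
  (theta : 'rV[R]_d) (r : R) (k i j : nat) : R :=
  pathsum ell k L (fun v => Rintegral mu (box (ell 0%N) a b) (fun x =>
    2 * (Rr (powR r (maxn (k - 1) 1)%:R^-1)
             (netN ell (act_r Rr r) theta x (maxn (k - 1) 1) j) * ind (1 < k <= L)%N
         + ith x j * ind (k == 1%N))
      * ind (v k == i)
      * (netN ell (act_r Rr r) theta x L (v L) - ith (f x) (v L))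
      * prod_r ell L Rr r theta x v k)).

Definition rhsB_r {R : realType} {d : nat} (ell : nat -> nat) (L : nat)
  (mu : {measure set (BorelRV R (ell 0%N)) -> \bar R}) (a b : R)
  (Rr : R -> R -> R) (f : BorelRV R (ell 0%N) -> 'rV[R]_(ell L))
  (theta : 'rV[R]_d) (r : R) (k i : nat) : R :=
  pathsum ell k L (fun v => Rintegral mu (box (ell 0%N) a b) (fun x =>
    2 * ind (v k == i)
      * (netN ell (act_r Rr r) theta x L (v L) - ith (f x) (v L))
      * prod_r ell L Rr r theta x v k)).

Definition rhsW_inf {R : realType} {d : nat} (ell : nat -> nat) (L : nat)
  (mu : {measure set (BorelRV R (ell 0%N)) -> \bar R}) (a b : R)
  (f : BorelRV R (ell 0%N) -> 'rV[R]_(ell L))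
  (theta : 'rV[R]_d) (k i j : nat) : R :=
  pathsum ell k L (fun v => Rintegral mu (box (ell 0%N) a b) (fun x =>
    2 * (relu (netN ell act_inf theta x (maxn (k - 1) 1) j) * ind (1 < k <= L)%N
         + ith x j * ind (k == 1%N))
      * ind (v k == i)
      * (netN ell act_inf theta x L (v L) - ith (f x) (v L))
      * prod_inf ell L a b theta x v k)).

Definition rhsB_inf {R : realType} {d : nat} (ell : nat -> nat) (L : nat)
  (mu : {measure set (BorelRV R (ell 0%N)) -> \bar R}) (a b : R)
  (f : BorelRV R (ell 0%N) -> 'rV[R]_(ell L))
  (theta : 'rV[R]_d) (k i : nat) : R :=
  pathsum ell k L (fun v => Rintegral mu (box (ell 0%N) a b) (fun x =>
    2 * ind (v k == i)
      * (netN ell act_inf theta x L (v L) - ith (f x) (v L))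
      * prod_inf ell L a b theta x v k)).

(* Main.v *)
(** The gradient of the loss is obtained by differentiating under the integral
    sign: along every line in parameter space the integrand is differentiable,
    with derivative bounded by a multiple of the integrable envelope
    [1 + |f|^2], so the loss has directional derivatives given by dominated
    convergence; they are linear in the direction and continuous in the
    parameter, so the loss is C^1. Backpropagation (unrolling the recursion for
    the directional derivative of the network) turns a partial derivative into
    a sum over paths of neurons.

    For the limit [r -> oo] the point is that the error of layer [k + 1] of the
    network is [O(r^(-1/k))] ([0] for the first layer), while the activation
    after that layer is switched off below [A r^(-1/(k+1))]. As
    [r^(-1/k) = o(r^(-1/(k+1)))], a neuron whose limit is exactly [0] is
    eventually in the region where the activation vanishes, so the derivatives of the activations converge pointwise to the indicators of the
    active regions, also at the kink of the ReLU. Dominated convergence then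
    gives the limit of the gradients. *)

Require Import Defs.
From HB Require Import structures.
From mathcomp Require Import all_boot all_order all_algebra.
From mathcomp Require Import all_classical all_reals all_analysis.
From mathcomp Require Import measurable_realfun.
From mathcomp Require Import zify ring lra.
Import Order.TTheory GRing.Theory Num.Theory.
Import numFieldNormedType.Exports.
Local Open Scope classical_set_scope.
Local Open Scope ring_scope.

(** * The network and its directional derivatives *)

Lemma ithD (R : nzRingType) n (u v : 'rV[R]_n) m : ith (u + v) m = ith u m + ith v m.
Proof.
case: m => [|m] /=; first by rewrite addr0.
by case: insubP => [i _ _|_]; rewrite ?mxE ?addr0.
Qed.

Lemma ithZ (R : nzRingType) n c (u : 'rV[R]_n) m : ith (c *: u) m = c * ith u m.
Proof.
case: m => [|m] /=; first by rewrite mulr0.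
by case: insubP => [i _ _|_]; rewrite ?mxE ?mulr0.
Qed.

Lemma ithS (R : nzRingType) n (u : 'rV[R]_n) (p : 'I_n) : ith u p.+1 = u 0 p.
Proof. by rewrite /= insubT//= => lt_pn; congr (u 0 _); exact: val_inj. Qed.

(** The norm on row vectors is the maximum norm, and the default value [0] outside the range obeys
    the bound as well. *)
Lemma ith_norm {R : realType} {n} (u : 'rV[R]_n) m : `|ith u m| <= `|u|.
Proof.
case: m => [|m] /=; first by rewrite normr0.
case: insubP => [i _ _|_]; last by rewrite normr0.
by rewrite [leRHS]mx_normrE; apply/bigmax_geP; right; exists (0, i).
Qed.

Lemma ith_ebasis (R : nzRingType) d m m' : (0 < m' <= d)%N ->
  ith (ebasis d m : 'rV[R]_d) m' = (m' == m)%:R.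
Proof.
case: m' => //= p pd; case: insubP => [i _ ip|/negP//].
by rewrite mxE ip; case: eqP.
Qed.

Lemma ith_cvg (R : realType) n (T : Type) (F : set_system T) {FF : Filter F}
    (u : T -> 'rV[R]_n) (l : 'rV[R]_n) m :
  u @ F --> l -> (fun t => ith (u t) m) @ F --> ith l m.
Proof.
move=> ul; case: m => [|m] /=; first exact: cvg_cst.
case: insubP => [i _ _|_]; last exact: cvg_cst.
by apply: (cvg_comp u (fun M : 'rV[R]_n => M 0 i) ul); exact: coord_continuous.
Qed.

Lemma cvgr_sum (R : realType) (V : normedModType R) (I : Type) (r : seq I)
    (P : pred I) (T : Type) (F : set_system T) {FF : Filter F} (u : I -> T -> V)
    (l : I -> V) :
  (forall i, P i -> u i @ F --> l i) ->
  (fun t => \sum_(i <- r | P i) u i t) @ F --> \sum_(i <- r | P i) l i.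
Proof. by move=> ul; apply: cvg_big => // -[y z]; exact: add_continuous. Qed.

Section network.
Context {R : realType} {n0 d : nat} (ell : nat -> nat).
Implicit Types (act D : nat -> R -> R) (th h : 'rV[R]_d) (x : 'rV[R]_n0).

(** Treats the input layer and the hidden layers alike, so that the recursions for [netN] and its
    derivative need no case distinction on the first layer. *)
Definition layer_input act th x k j : R :=
  if k is 0%N then ith x j else act k (netN ell act th x k j).

Lemma netNS act th x k i : netN ell act th x k.+1 i =
  bias ell th k.+1 i +
  \sum_(j < ell k) wgt ell th k.+1 i j.+1 * layer_input act th x k j.+1.
Proof. by []. Qed.

(** Formal derivative of [netN] in the parameter direction [h]; [D k] stands
    for the derivative of the activation [act k], and is the indicator of the
    positive half line in the ReLU limit. *)
Fixpoint dnetN act D th h x (k i : nat) : R :=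
  if k is k'.+1 then
    bias ell h k i + \sum_(j < ell k')
      (wgt ell h k i j.+1 * layer_input act th x k' j.+1 +
       wgt ell th k i j.+1 *
         (D k' (netN ell act th x k' j.+1) * dnetN act D th h x k' j.+1))
  else 0.

Lemma dnetND act D th h1 h2 x k i :
  dnetN act D th (h1 + h2) x k i =
  dnetN act D th h1 x k i + dnetN act D th h2 x k i.
Proof.
elim: k i => [|k IH] i /=; first by rewrite addr0.
rewrite /bias /wgt ithD addrACA -big_split /=; congr (_ + _).
by apply: eq_bigr => j _; rewrite ithD IH; ring.
Qed.

Lemma dnetNZ act D th c h x k i :
  dnetN act D th (c *: h) x k i = c * dnetN act D th h x k i.
Proof.
elim: k i => [|k IH] i /=; first by rewrite mulr0.
rewrite /bias /wgt ithZ mulrDr mulr_sumr; congr (_ + _).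
by apply: eq_bigr => j _; rewrite ithZ IH; ring.
Qed.

(** Linearity in the direction reduces everything to coordinate directions, that is, to partial
    derivatives. *)
Lemma dnetN_sum act D th h x k i :
  dnetN act D th h x k i = \sum_(p < d) h 0 p * dnetN act D th (ebasis d p.+1) x k i.
Proof.
have {1}-> : h = \sum_(p < d) h 0 p *: (ebasis d p.+1 : 'rV[R]_d).
  apply/rowP => q; rewrite summxE (bigD1 q)//= !mxE eqxx mulr1.
  rewrite big1 ?addr0// => p pq; rewrite !mxE eqSS.
  by rewrite [(q == p :> nat)](negbTE _) ?mulr0// eq_sym.
elim/big_rec2: _ => [|p y1 y2 _ <-].
  by rewrite -(scale0r (0 : 'rV[R]_d)) dnetNZ mul0r.
by rewrite dnetND dnetNZ.
Qed.

Lemma layer_input_cvg (T : Type) (F : set_system T) {FF : Filter F}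
    (actt : T -> nat -> R -> R) act (tht : T -> 'rV[R]_d) th x k j :
  (forall (y : T -> R) l, (0 < k)%N -> y @ F --> l ->
     (fun t => actt t k (y t)) @ F --> act k l) ->
  (fun t => netN ell (actt t) (tht t) x k j) @ F --> netN ell act th x k j ->
  (fun t => layer_input (actt t) (tht t) x k j) @ F --> layer_input act th x k j.
Proof.
move=> ca cN; case: k => [|k] in ca cN *; first exact: cvg_cst.
exact: ca.
Qed.

(** Activations are assumed to converge along every convergent argument. This covers a fixed
    continuous activation with moving parameters as well as activations that move towards the
    ReLU. *)
Lemma netN_cvg (T : Type) (F : set_system T) {FF : Filter F}
    (actt : T -> nat -> R -> R) act (tht : T -> 'rV[R]_d) th x k i :
  (forall m (y : T -> R) l, (0 < m)%N -> y @ F --> l ->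
     (fun t => actt t m (y t)) @ F --> act m l) ->
  tht @ F --> th ->
  (fun t => netN ell (actt t) (tht t) x k i) @ F --> netN ell act th x k i.
Proof.
move=> ca cth; elim: k i => [|k IH] i; first exact: cvg_cst.
under eq_fun do rewrite netNS.
rewrite netNS; apply: cvgD; first exact: ith_cvg.
apply: cvgr_sum => j _; apply: cvgM; first exact: ith_cvg.
by apply: layer_input_cvg => // y l; exact: ca.
Qed.

(** The derivatives [Dt] need to converge only along the values of the network itself, because the
    limit [D] may be discontinuous, as the ReLU derivative is at [0]. *)
Lemma dnetN_cvg (T : Type) (F : set_system T) {FF : Filter F}
    (actt Dt : T -> nat -> R -> R) act D (tht : T -> 'rV[R]_d) th h x k i :
  (forall m (y : T -> R) l, (0 < m)%N -> y @ F --> l ->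
     (fun t => actt t m (y t)) @ F --> act m l) ->
  (forall m j, (0 < m)%N ->
    (fun t => Dt t m (netN ell (actt t) (tht t) x m j)) @ F -->
    D m (netN ell act th x m j)) ->
  tht @ F --> th ->
  (fun t => dnetN (actt t) (Dt t) (tht t) h x k i) @ F --> dnetN act D th h x k i.
Proof.
move=> ca cD cth; elim: k i => [|k IH] i; first exact: cvg_cst.
rewrite [dnetN]lock /=; rewrite -lock /=.
apply: cvgD; first exact: cvg_cst.
apply: cvgr_sum => j _; apply: cvgD.
  apply: cvgM; first exact: cvg_cst.
  by apply: layer_input_cvg => [y l|]; [exact: ca|exact: netN_cvg].
apply: cvgM; first exact: ith_cvg.
(* At layer [0] nothing is known about [Dt], but there it is multiplied by [dnetN] at level [0],
   which is [0]. *)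
case: k IH j => [|k] IH j; last by apply: cvgM => //; exact: cD.
by rewrite /= mulr0; under eq_fun do rewrite mulr0; exact: cvg_cst.
Qed.

Lemma netN_is_derive act th h x k i (t : R) :
  (forall m y, derivable (act m) y 1) ->
  is_derive t 1 (fun s : R => netN ell act (th + s *: h) x k i)
    (dnetN act (fun m => derive1 (act m)) (th + t *: h) h x k i).
Proof.
move=> da.
have ith_der m : is_derive t 1 (fun s : R => ith (th + s *: h) m) (ith h m).
  under eq_fun do rewrite ithD ithZ.
  have -> : (fun s => ith th m + s * ith h m) =
    (cst (ith th m) + ( (id : R -> R) * cst (ith h m))) by exact/funext.
  by apply: is_derive_eq; rewrite scaler0 !add0r/= /GRing.scale/= mulr1.
elim: k i => [|k IH] i; first exact: is_derive_cst.
have -> : (fun s => netN ell act (th + s *: h) x k.+1 i) =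
   (fun s => bias ell (th + s *: h) k.+1 i) +
   \sum_(j < ell k) ((fun s => wgt ell (th + s *: h) k.+1 i j.+1) *
     (fun s => layer_input act (th + s *: h) x k j.+1)).
  by apply/funext => s; rewrite netNS; rewrite !fctE fct_sumE.
rewrite /bias /wgt /=; apply: is_deriveD.
apply: is_derive_sum => j.
(* The network input is constant in the parameter; at later layers this is the chain rule. *)
have dL : is_derive t 1 (fun s => layer_input act (th + s *: h) x k j.+1)
    (derive1 (act k) (netN ell act (th + t *: h) x k j.+1) *
     dnetN act (fun m => derive1 (act m)) (th + t *: h) h x k j.+1).
  case: k IH j => [|k] IH j.
    by rewrite /= mulr0; exact: is_derive_cst.
  apply: (@is_derive1_comp _ (act k.+1)).
  by apply: DeriveDef; [exact: da|rewrite derive1E].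
by apply: is_derive_eq; rewrite /wgt addrC; congr (_ + _); exact: mulrC.
Qed.

End network.

(** * Borel measurability of the network in its input *)

Lemma continuous_measurable_BorelRV (R : realType) n (F : 'rV[R]_n -> R) :
  continuous F -> measurable_fun setT (F : BorelRV R n -> R).
Proof.
move=> /continuousP cF; apply: (measurability _ (measurable_realfun.RGenOpens.measurableE R)).
move=> _ [_ [a [b ->] <-]]; rewrite setTI; apply: sub_sigma_algebra.
exact/cF/interval_open.
Qed.

Lemma measurable_ith (R : realType) n j :
  measurable_fun setT (fun x : BorelRV R n => ith x j).
Proof.
apply: (@continuous_measurable_BorelRV R n (fun v => ith v j)) => v.
exact: (@ith_cvg R n _ (nbhs v) _ id v j cvg_id).
Qed.

Lemma measurable_box (R : realType) n (a b : R) : measurable (box n a b).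
Proof.
have -> : box n a b = \bigcap_(i in [set: 'I_n]) [set x | a <= x 0 i <= b].
  by apply/seteqP; split => x /= xab i; [move=> _; exact: xab|exact: xab].
apply: fin_bigcap_measurable => // i _.
have := measurable_ith R n i.+1.
under eq_fun do rewrite ithS.
move=> /(_ measurableT _ (measurable_itv `[a, b])); congr measurable.
by apply/seteqP; split => x /=; rewrite in_itv/=; [case|].
Qed.

Lemma box_ith_le {R : realType} {n} {a b : R} {x : BorelRV R n} : box n a b x ->
  forall j, `|ith x j| <= `|a| + `|b|.
Proof.
move=> xab [|j] /=; first by rewrite normr0 addr_ge0.
case: insubP => [i _ _|_]; last by rewrite normr0 addr_ge0.
have /andP[ax xb] := xab i; have := ler_norm (- a); have := ler_norm b.
have := normr_ge0 a; have := normr_ge0 b; rewrite normrN ler_norml; lra.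
Qed.

Section network_measurability.
Context {R : realType} {n0 d : nat} (ell : nat -> nat) (act D : nat -> R -> R).
Hypothesis mact : forall m, measurable_fun setT (act m).
Hypothesis mD : forall m, measurable_fun setT (D m).
Implicit Types th h : 'rV[R]_d.

Lemma measurable_netN th k i :
  measurable_fun setT (fun x : BorelRV R n0 => netN ell act th x k i).
Proof.
elim: k i => [|k IH] i; first exact: measurable_cst.
under eq_fun do rewrite netNS.
apply: measurable_funD; first exact: measurable_cst.
apply: measurable_sum => j; apply: measurable_funM; first exact: measurable_cst.
case: k IH j => [|k] IH j; first exact: measurable_ith.
exact: measurableT_comp.
Qed.

Lemma measurable_layer_input th k j :
  measurable_fun setT (fun x : BorelRV R n0 => layer_input ell act th x k j).
Proof.
case: k => [|k]; first exact: measurable_ith.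
by apply: measurableT_comp => //; exact: measurable_netN.
Qed.

Lemma measurable_dnetN th h k i :
  measurable_fun setT (fun x : BorelRV R n0 => dnetN ell act D th h x k i).
Proof.
elim: k i => [|k IH] i; first exact: measurable_cst.
rewrite /=; apply: measurable_funD; first exact: measurable_cst.
apply: measurable_sum => j; apply: measurable_funD.
  by apply: measurable_funM; [exact: measurable_cst|exact: measurable_layer_input].
apply: measurable_funM; first exact: measurable_cst.
apply: measurable_funM; last exact: IH.
by apply: measurableT_comp => //; exact: measurable_netN.
Qed.

End network_measurability.

(** * Bounds uniform over bounded sets of parameters *)

Section network_bounds.
Context {R : realType} {n0 d : nat} (ell : nat -> nat).
Implicit Types (act D : nat -> R -> R) (th h : 'rV[R]_d) (x : 'rV[R]_n0).

Lemma netN_bounded (X K : R) k : exists2 M : R, 0 <= M & forall act th x i,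
  (forall m y, `|act m y| <= `|y|) -> `|th| <= K ->
  (forall j, `|ith x j| <= X) ->
  `|netN ell act th x k i| <= M /\ `|layer_input ell act th x k i| <= M.
Proof.
elim: k => [|k [M M0 IH]].
  exists `|X| => // act th x i _ _ xX /=; rewrite normr0; split => //.
  exact: le_trans (xX i) (ler_norm _).
exists (`|K| + (ell k)%:R * (`|K| * M)) => [|act th x i hact thK xX].
  by rewrite addr_ge0// mulr_ge0// mulr_ge0.
have ithK m : `|ith th m| <= `|K|.
  by rewrite (le_trans (ith_norm _ _))// (le_trans thK)// ler_norm.
have NM : `|netN ell act th x k.+1 i| <= `|K| + (ell k)%:R * (`|K| * M).
  rewrite netNS (le_trans (ler_normD _ _))// lerD//; first exact: ithK.
  rewrite (le_trans (ler_norm_sum _ _ _))//.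
  rewrite -[X in X%:R]card_ord mulr_natl -sumr_const.
  apply: ler_sum => j _; rewrite normrM ler_pM//; first exact: ithK.
  by have [] := IH act th x j.+1 hact thK xX.
by split => //; rewrite (le_trans (hact _ _)).
Qed.

Lemma dnetN_bounded (X K C : R) k : exists2 M : R, 0 <= M & forall act D th h x i,
  (forall m y, `|act m y| <= `|y|) -> (forall m y, `|D m y| <= C) ->
  `|th| <= K -> `|h| <= K -> (forall j, `|ith x j| <= X) ->
  `|dnetN ell act D th h x k i| <= M.
Proof.
elim: k => [|k [M M0 IH]].
  by exists 0 => // act D th h x i *; rewrite normr0.
have [M' M'0 NM'] := netN_bounded X K k.
exists (`|K| + (ell k)%:R * (`|K| * M' + `|K| * (`|C| * M))).
  by rewrite addr_ge0// mulr_ge0// addr_ge0// !mulr_ge0.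
move=> act D th h x i hact hD thK hK xX.
have ithK (u : 'rV[R]_d) m : `|u| <= K -> `|ith u m| <= `|K|.
  by move=> uK; rewrite (le_trans (ith_norm _ _))// (le_trans uK)// ler_norm.
rewrite /= (le_trans (ler_normD _ _))// lerD//; first exact: ithK.
rewrite (le_trans (ler_norm_sum _ _ _))//.
rewrite -[X in X%:R]card_ord mulr_natl -sumr_const.
apply: ler_sum => j _; rewrite (le_trans (ler_normD _ _))// !normrM lerD//.
  rewrite ler_pM//; first exact: ithK.
  by have [] := NM' act th x j.+1 hact thK xX.
rewrite ler_pM// ?mulr_ge0//; first exact: ithK.
rewrite ler_pM//; last exact: IH.
exact: le_trans (hD _ _) (ler_norm _).
Qed.

End network_bounds.

(** * Limits, integrals and differentiability *)

(** If convergence failed, every ball of radius [1/(n+1)] would contain a bad point, and choosing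
    one for each [n] gives a contradicting sequence. It makes dominated convergence, a statement on
    sequences, available for continuity. *)
Lemma cvg_at_seq (R : realType) (V : normedModType R) (F : V -> R) (p : V) (l : R) :
  (forall u : nat -> V, u @ \oo --> p -> (fun n => F (u n)) @ \oo --> l) ->
  F @ p --> l.
Proof.
move=> hF; apply: contrapT => NF.
have [e e0 He] : exists2 e : R, 0 < e &
    forall n : nat, exists v : V, `|v - p| < n.+1%:R^-1 /\ e <= `|F v - l|.
  apply: contrapT => NH; apply: NF; apply/cvgrPdist_lt => e e0.
  have [n Hn] : exists n : nat, forall v : V, `|v - p| < n.+1%:R^-1 -> `|F v - l| < e.
    apply: contrapT => Nn; apply: NH; exists e => // n.
    apply: contrapT => Nv; apply: Nn; exists n => v vp.
    by rewrite ltNge; apply/negP => eF; apply: Nv; exists v.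
  near=> v; rewrite distrC; apply: Hn.
  by near: v; apply: cvgr_distC_lt => //; rewrite invr_gt0.
have [u Hu] := choice He.
have up : u @ \oo --> p.
  apply/cvgrPdist_lt => r r0; near=> n.
  rewrite distrC (lt_trans (Hu n).1)//.
  by near: n; exact: near_infty_natSinv_lt (PosNum r0).
have /cvgrPdist_lt/(_ _ e0)[n _ /(_ n (leqnn n))] := hF u up.
by rewrite distrC ltNge (Hu n).2.
Unshelve. all: by end_near. Qed.

(** Dropping the first [N] terms turns eventual domination into domination for all [n];
    measurability of the limit comes from pointwise convergence. *)
Lemma dominated_cvg_Rintegral d (T : measurableType d) (R : realType)
    (mu : {measure set T -> \bar R}) (B : set T) (mB : measurable B)
    (u : nat -> T -> R) (v g : T -> R) :
  (\forall n \near \oo, measurable_fun B (u n) /\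
    forall x, B x -> `|u n x| <= g x) ->
  mu.-integrable B (EFin \o g) ->
  (forall x, B x -> (fun n => u n x) @ \oo --> v x) ->
  (fun n => Rintegral mu B (u n)) @ \oo --> Rintegral mu B v.
Proof.
move=> [N _ uN] ig uv; rewrite -(cvg_shiftn N).
have {}uN n := uN (n + N)%N (leq_addl n N).
have uv' x : B x -> (fun n => u (n + N)%N x) @ \oo --> v x.
  by move=> Bx; rewrite (cvg_shiftn N (fun n => u n x)); exact: uv.
have mu' n : measurable_fun B (EFin \o u (n + N)%N) by apply/measurable_EFinP; exact: (uN n).1.
have gu n x : B x -> (`|(u (n + N)%N x)%:E| <= (EFin \o g) x)%E.
  by move=> Bx; rewrite lee_fin; exact: (uN n).2.
have cu x : B x -> (fun n => (u (n + N)%N x)%:E) @ \oo --> (v x)%:E.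
  by move=> Bx; apply: cvg_EFin; [exact: nearW|exact: uv'].
have mv : measurable_fun B (EFin \o v).
  exact: (emeasurable_fun_cvg (fun n x => (u (n + N)%N x)%:E)).
have [iv _] := @dominated_convergence _ _ _ mu B mB
  (fun n x => (u (n + N)%N x)%:E) (EFin \o v) (EFin \o g) mu' mv
  (aeW mu cu) ig (aeW mu (fun x n => @gu n x)).
move=> cvI; apply: fine_cvg; rewrite fineK; first exact: cvI.
exact: integrable_fin_num.
Qed.

Definition dotv {R : realType} {d : nat} (g h : 'rV[R]_d) : R :=
  \sum_(p < d) h 0 p * g 0 p.

Lemma dotv_is_linear (R : realType) d (g : 'rV[R]_d) : linear (dotv g).
Proof.
move=> c u v; rewrite /dotv /GRing.scale/= mulr_sumr -big_split/=.
by apply: eq_bigr => p _; rewrite !mxE mulrDl mulrA.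
Qed.

HB.instance Definition _ (R : realType) d (g : 'rV[R]_d) :=
  GRing.isLinear.Build R 'rV[R]_d R *:%R (dotv g) (@dotv_is_linear R d g).

(** Since [|h|] is the maximum norm, summing [d] products costs the factor [d]. *)
Lemma dotv_le (R : realType) d (g h : 'rV[R]_d) e :
  (forall p, `|g 0 p| <= e) -> `|dotv g h| <= d%:R * e * `|h|.
Proof.
move=> ge; rewrite (le_trans (ler_norm_sum _ _ _))//.
rewrite -mulrA -[X in X%:R]card_ord mulr_natl -sumr_const.
apply: ler_sum => p _; rewrite normrM mulrC ler_pM//.
by rewrite -ithS ith_norm.
Qed.

Lemma continuous_dotv (R : realType) d (g : 'rV[R]_d) : continuous (dotv g).
Proof.
move=> u; apply: (@cvgr_sum _ _ _ _ _ _ (nbhs u)) => p _.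
by apply: cvgMr_tmp; exact: coord_continuous.
Qed.

(** The estimate says [F (h + x) = F x + df h + o(h)], and uniqueness of the differential identifies
    it with [df]. *)
Lemma differentiable_of_linear_approx (R : realType) (V W : normedModType R)
    (F : V -> W) (df : {linear V -> W}) (x : V) : continuous df ->
  (forall e : R, 0 < e -> \forall h \near (0 : V),
     `|F (h + x) - (F x + df h)| <= e * `|h|) ->
  differentiable F x /\ 'd F x = df :> (V -> W).
Proof.
move=> cdf Fx.
have oF : F \o shift x = cst (F x) + df +o_ 0 id.
  by apply/eqaddoP => e e0; exact: Fx.
have dFE := diff_unique cdf oF.
by split => //; apply/diff_locallyP; rewrite dFE.
Qed.

(* Along the segment from [th] to [th + h] the increment of [F] is
   [dotv (G (th + t h)) h] for some [t] in [0, 1], by the mean value theorem. *)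
Lemma differentiable_of_directional (R : realType) d (F : 'rV[R]_d -> R)
    (G : 'rV[R]_d -> 'rV[R]_d) (th : 'rV[R]_d) :
  (forall u h (t : R), is_derive t 1 (fun s : R => F (u + s *: h))
     (dotv (G (u + t *: h)) h)) ->
  (forall p, (fun u => G u 0 p) @ th --> G th 0 p) ->
  differentiable F th /\ forall h, 'D_h F th = dotv (G th) h.
Proof.
move=> dF cG.
have [diffF dFE] : differentiable F th /\ 'd F th = dotv (G th) :> (_ -> _).
  apply: differentiable_of_linear_approx => [|e e0]; first exact: continuous_dotv.
  (* The division compensates the factor [d] of [dotv_le]; the [+ 1] keeps the denominator positive
     when [d = 0]. *)
  pose e' := e / (d%:R + 1).
  have e'0 : 0 < e' by rewrite divr_gt0// ltr_wpDl.
  have : \forall u \near th, forall p, `|G u 0 p - G th 0 p| <= e'.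
    apply: (@filter_forall _ _ _ (nbhs th)) => p.
    by have /cvgrPdistC_le/(_ _ e'0) := cG p.
  move=> /nbhs_ballP[r /= r0 Hr]; apply/nbhs_ballP; exists r => //= h.
  rewrite -ball_normE/= sub0r normrN => hr.
  have dFs (s : R) : is_derive s 1 (fun s : R => F (th + s *: h)) (dotv (G (th + s *: h)) h).
    exact: dF.
  have cFs : {within `[0, 1], continuous (fun s : R => F (th + s *: h))}.
    apply: continuous_subspaceT => s.
    by apply/differentiable_continuous/derivable1_diffP; have [] := dFs s.
  have [t t01] := MVT_segment ler01 (fun s _ => dFs s) cFs.
  rewrite scale1r scale0r addr0 subr0 mulr1 => Fth.
  rewrite [h + th]addrC.
  have -> : F (th + h) - (F th + dotv (G th) h) =
      dotv (G (th + t *: h) - G th) h.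
    rewrite opprD addrA Fth /dotv -sumrB; apply: eq_bigr => p _.
    by rewrite !mxE mulrBr.
  (* As [t] lies in [[0, 1]], the intermediate point stays in the ball around [th] that contains
     [th + h]. *)
  have Ge p : `|(G (th + t *: h) - G th) 0 p| <= e'.
    rewrite !mxE; apply: Hr; rewrite -ball_normE/= opprD addNKr normrN normrZ.
    move: t01; rewrite in_itv/= => /andP[t0 t1]; rewrite ger0_norm//.
    by rewrite (le_lt_trans _ hr)// ler_piMl.
  rewrite (le_trans (dotv_le _ _ _ _ _ Ge))// ler_wpM2r//.
  by rewrite /e' mulrA ler_pdivrMr ?ltr_wpDl// mulrC ler_pM2l// lerDl.
by split => // h; rewrite deriveE// dFE.
Qed.

Lemma row_cvg (R : realType) n (T : Type) (F : set_system T) {FF : Filter F}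
    (u : T -> 'rV[R]_n) (l : 'rV[R]_n) :
  (forall p, (fun t => u t 0 p) @ F --> l 0 p) -> u @ F --> l.
Proof.
move=> ul; rewrite (row_sum_delta l).
rewrite (_ : u = fun t => \sum_j u t 0 j *: delta_mx 0 j); last first.
  by apply/funext => t; exact: row_sum_delta.
by apply: cvgr_sum => p _; apply: cvgZr_tmp; exact: ul.
Qed.

(** * Regularity of the loss *)

(** What the smooth activations and the ReLU have in common. [D] is a separate argument because the
    ReLU has no derivative at [0]. *)
Record admissible {R : realType} (C : R) (act D : nat -> R -> R) : Prop := {
  act_le : forall m y, `|act m y| <= `|y|;
  D_le : forall m y, `|D m y| <= C;
  measurable_act : forall m, measurable_fun setT (act m);
  measurable_D : forall m, measurable_fun setT (D m) }.

Section loss.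
Context {R : realType} {L d : nat} {ell : nat -> nat} {a b : R}
  {mu : {measure set (BorelRV R (ell 0%N)) -> \bar R}}
  {f : BorelRV R (ell 0%N) -> 'rV[R]_(ell L)}.
Implicit Types (act D : nat -> R -> R) (th h : 'rV[R]_d).
Local Notation bx := (box (ell 0%N) a b).

Definition dsqerr act D th h (x : BorelRV R (ell 0%N)) : R :=
  \sum_(i < ell L) 2 * (netN ell act th x L i.+1 - ith (f x) i.+1) *
    dnetN ell act D th h x L i.+1.

Definition dloss act D th h : R := Rintegral mu bx (dsqerr act D th h).

Definition envelope (x : BorelRV R (ell 0%N)) : R :=
  1 + \sum_(i < ell L) ith (f x) i.+1 ^+ 2.

Hypothesis mu_fin : (mu bx < +oo)%E.
Hypothesis mf : forall i : 'I_(ell L), measurable_fun bx (fun x => f x 0 i).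
Hypothesis f2_fin :
  (\int[mu]_(x in bx) (\sum_(i < ell L) ith (f x) i.+1 ^+ 2)%:E < +oo)%E.

Lemma measurable_ith_f m : measurable_fun bx (fun x => ith (f x) m).
Proof.
case: m => [|m]; first exact: measurable_cst.
have [lt_mL|] := ltnP m (ell L).
  by under eq_fun do rewrite (ithS _ _ _ (Ordinal lt_mL)); exact: mf.
move=> Lm; rewrite (_ : (fun x => _) = cst 0); first exact: measurable_cst.
by apply/funext => x /=; case: insubP => // i; rewrite ltnNge Lm.
Qed.

Lemma envelope_ge1 x : 1 <= envelope x.
Proof. by rewrite lerDl sumr_ge0// => i _; exact: sqr_ge0. Qed.

(** This rests on [|y| <= 1 + y^2]: the square-integrable majorant also controls terms linear in
    [f]. *)
Lemma ith_f_le_envelope x m : `|ith (f x) m| <= envelope x.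
Proof.
case: m => [|m]; first by rewrite normr0 (le_trans ler01)// envelope_ge1.
have [lt_mL|Lm] := ltnP m (ell L); last first.
  rewrite /=; case: insubP => [i|_]; first by rewrite ltnNge Lm.
  by rewrite normr0 (le_trans ler01)// envelope_ge1.
rewrite /envelope (bigD1 (Ordinal lt_mL))//= -/(ith (f x) m.+1).
set y := ith _ _; set s := \sum_(i < _ | _) _.
have s0 : 0 <= s by apply: sumr_ge0 => i _; exact: sqr_ge0.
rewrite ler_norml; nra.
Qed.

Lemma integrable_envelope : mu.-integrable bx (EFin \o envelope).
Proof.
have mbx : measurable bx by exact: measurable_box.
have ms : measurable_fun bx
    (fun x : BorelRV R (ell 0%N) => \sum_(i < ell L) ith (f x) i.+1 ^+ 2).
  by apply: measurable_sum => i; apply: measurable_funX; exact: measurable_ith_f.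
rewrite (_ : EFin \o envelope = (EFin \o cst 1) \+
  (EFin \o (fun x => \sum_(i < ell L) ith (f x) i.+1 ^+ 2))); last first.
  by apply/funext => x /=; rewrite EFinD.
apply: integrableD => //; apply/integrableP; split.
- exact/measurable_EFinP/measurable_cst.
- under eq_integral do rewrite /= normr1.
  by rewrite integral_cst// mul1e.
- exact/measurable_EFinP.
- under eq_integral => x _.
    rewrite /= ger0_norm; first over.
    by apply: sumr_ge0 => i _; exact: sqr_ge0.
  exact: f2_fin.
Qed.

Lemma integrable_le_envelope c (g : BorelRV R (ell 0%N) -> R) :
  measurable_fun bx g -> (forall x, bx x -> `|g x| <= c * envelope x) ->
  mu.-integrable bx (EFin \o g).
Proof.
move=> mg gc; have mbx : measurable bx by exact: measurable_box.
apply: (le_integrable mbx _ _ (integrableZl mbx c integrable_envelope)).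
- exact/measurable_EFinP.
- move=> x Dx; rewrite -EFinM /= lee_fin.
  exact: le_trans (gc x Dx) (ler_norm _).
Qed.

Lemma measurable_residual C act D th i : admissible C act D ->
  measurable_fun bx (fun x : BorelRV R (ell 0%N) =>
    netN ell act th x L i - ith (f x) i).
Proof.
move=> adm; apply: measurable_funB; last exact: measurable_ith_f.
by apply: measurable_funTS; apply: measurable_netN; exact: measurable_act adm.
Qed.

Lemma measurable_sqerr C act D th : admissible C act D ->
  measurable_fun bx (sqerr ell L act th f).
Proof.
move=> adm; apply: measurable_sum => i; apply: measurable_funX.
exact: measurable_residual adm.
Qed.

Lemma measurable_dsqerr C act D th h : admissible C act D ->
  measurable_fun bx (dsqerr act D th h).
Proof.
move=> adm; apply: measurable_sum => i; apply: measurable_funM.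
  apply: measurable_funM; first exact: measurable_cst.
  exact: measurable_residual adm.
apply: measurable_funTS; apply: measurable_dnetN.
- exact: measurable_act adm.
- exact: measurable_D adm.
Qed.

Lemma sqerr_le_envelope (C K : R) : exists c : R, forall act D th h x,
  admissible C act D -> `|th| <= K -> `|h| <= K -> bx x ->
  `|sqerr ell L act th f x| <= c * envelope x /\
  `|dsqerr act D th h x| <= c * envelope x.
Proof.
have [M M0 HM] := @netN_bounded R (ell 0%N) d ell (`|a| + `|b|) K L.
have [M' M'0 HM'] := @dnetN_bounded R (ell 0%N) d ell (`|a| + `|b|) K C L.
(* Per output neuron, [2 M^2 + 2] serves the squared error and [2 (M + 1) M'] its derivative. *)
exists ((ell L)%:R * (2 * M ^+ 2 + 2 + 2 * (M + 1) * M')) => act D th h x adm thK hK bxx.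
have xX := box_ith_le bxx.
have N_le i : `|netN ell act th x L i| <= M.
  by have [] := HM act th x i (act_le _ _ _ adm) thK xX.
have dN_le i : `|dnetN ell act D th h x L i| <= M'.
  exact: HM' (act_le _ _ _ adm) (D_le _ _ _ adm) thK hK xX.
have E1 := envelope_ge1 x.
have f2_le (i : 'I_(ell L)) : ith (f x) i.+1 ^+ 2 <= envelope x.
  rewrite /envelope (bigD1 i)//= addrCA lerDl addr_ge0// sumr_ge0// => j _.
  exact: sqr_ge0.
rewrite -mulrA -[X in X%:R]card_ord mulr_natl -sumr_const.
split; rewrite (le_trans (ler_norm_sum _ _ _))//; apply: ler_sum => i _.
  rewrite ger0_norm ?sqr_ge0//.
  have NM2 : netN ell act th x L i.+1 ^+ 2 <= M ^+ 2.
    by rewrite -real_normK ?num_real// lerXn2r ?nnegrE.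
  (* Nonnegativity of [(N + f)^2] gives [(N - f)^2 <= 2 N^2 + 2 f^2]. *)
  have := f2_le i; have := sqr_ge0 (netN ell act th x L i.+1 + ith (f x) i.+1).
  have : 0 <= M ^+ 2 * (envelope x - 1) by rewrite mulr_ge0 ?sqr_ge0 ?subr_ge0.
  have : 0 <= (M + 1) * M' * envelope x.
    apply: mulr_ge0; last exact: le_trans ler01 E1.
    by apply: mulr_ge0 => //; rewrite addr_ge0.
  rewrite !sqrrD; lra.
rewrite !normrM ger0_norm//.
have : `|netN ell act th x L i.+1 - ith (f x) i.+1| *
    `|dnetN ell act D th h x L i.+1| <= ((M + 1) * envelope x) * M'.
  apply: ler_pM => //; rewrite (le_trans (ler_normB _ _))// mulrDl mul1r lerD//.
    by rewrite (le_trans (N_le _))// ler_peMr.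
  exact: ith_f_le_envelope.
have : 0 <= M ^+ 2 * envelope x.
  by apply: mulr_ge0; [exact: sqr_ge0|exact: le_trans ler01 E1].
lra.
Qed.

Lemma integrable_sqerr C act D th : admissible C act D ->
  mu.-integrable bx (EFin \o sqerr ell L act th f).
Proof.
move=> adm; have [c Hc] := sqerr_le_envelope C `|th|.
apply: (@integrable_le_envelope c); first exact: measurable_sqerr adm.
by move=> x bxx; have [] := Hc act D th 0 x adm (lexx _) _ bxx; rewrite ?normr0.
Qed.

Lemma integrable_dsqerr C act D th h : admissible C act D ->
  mu.-integrable bx (EFin \o dsqerr act D th h).
Proof.
move=> adm; have [c Hc] := sqerr_le_envelope C (`|th| + `|h|).
apply: (@integrable_le_envelope c); first exact: measurable_dsqerr adm.
by move=> x bxx; have [] := Hc act D th h x adm _ _ bxx; rewrite ?lerDl ?lerDr.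
Qed.

(** Dominated convergence with the envelope as majorant. It is used twice: with fixed activations
    for continuity of the gradient in the parameter, and with a fixed parameter for the limit
    [r -> oo]. *)
Lemma loss_dloss_seq_cvg C (actn Dn : nat -> nat -> R -> R) act D
    (thn : nat -> 'rV[R]_d) th h :
  (\forall n \near \oo, admissible C (actn n) (Dn n)) ->
  thn @ \oo --> th ->
  (forall m (y : nat -> R) l, (0 < m)%N -> y @ \oo --> l ->
     (fun n => actn n m (y n)) @ \oo --> act m l) ->
  (forall (x : 'rV[R]_(ell 0%N)) m j, (0 < m)%N ->
     (fun n => Dn n m (netN ell (actn n) (thn n) x m j)) @ \oo -->
     D m (netN ell act th x m j)) ->
  (fun n => loss ell L mu a b (actn n) f (thn n)) @ \oo --> loss ell L mu a b act f th /\
  (fun n => dloss (actn n) (Dn n) (thn n) h) @ \oo --> dloss act D th h.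
Proof.
move=> adm cth cact cD; have mbx : measurable bx by exact: measurable_box.
(* [|th| + 1] eventually bounds [thn]; the summand [|h|] makes [K] a bound for the direction too. *)
pose K := `|th| + 1 + `|h|.
have [c Hc] := sqerr_le_envelope C K.
have thK : \forall n \near \oo, `|thn n| <= K.
  have thlt : `|th| < `|th| + 1 by rewrite ltrDl.
  near=> n; have /ltW thn1 : `|thn n| < `|th| + 1 by near: n; exact: (cvgr_norm_lt _ cth _ thlt).
  by rewrite (le_trans thn1)// lerDl.
have hK : `|h| <= K by rewrite lerDr addr_ge0.
have ig : mu.-integrable bx (EFin \o (fun x => c * envelope x)).
  exact: (integrableZl mbx c integrable_envelope).
have cN (x : 'rV[R]_(ell 0%N)) i :
    (fun n => netN ell (actn n) (thn n) x L i) @ \oo --> netN ell act th x L i.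
  exact: netN_cvg.
have cR (x : BorelRV R (ell 0%N)) i :
    (fun n => netN ell (actn n) (thn n) x L i - ith (f x) i) @ \oo -->
    netN ell act th x L i - ith (f x) i.
  by apply: (cvgB (cN x i)); exact: cvg_cst.
split; apply: (dominated_cvg_Rintegral _ _ _ mu _ mbx _ _ (fun x => c * envelope x)) => //.
- near=> n; have admn : admissible C (actn n) (Dn n) by near: n.
  split; first exact: measurable_sqerr admn.
  move=> x bxx; have [] := Hc _ _ (thn n) h x admn _ hK bxx => //.
  by near: n.
- move=> x _; apply: cvgr_sum => i _.
  by apply: (cvg_comp _ (fun y : R => y ^+ 2) (cR x i.+1)); exact: exprn_continuous.
- near=> n; have admn : admissible C (actn n) (Dn n) by near: n.
  split; first exact: measurable_dsqerr admn.
  move=> x bxx; have [] := Hc _ _ (thn n) h x admn _ hK bxx => //.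
  by near: n.
- move=> x _; apply: cvgr_sum => i _; apply: cvgM; last first.
    exact: (dnetN_cvg ell _ _ actn Dn act D thn th h x L i.+1 cact (cD x) cth).
  by apply: cvgMl_tmp; exact: cR.
Unshelve. all: by end_near. Qed.

Section differentiability.
Context (C : R) (act : nat -> R -> R).
Let D m := derive1 (act m).
Hypothesis adm : admissible C act D.
Hypothesis derivable_act : forall m y, derivable (act m) y 1.
Hypothesis continuous_D : forall m, continuous (D m).

Lemma sqerr_is_derive th h x (t : R) :
  is_derive t 1 (fun s : R => sqerr ell L act (th + s *: h) f x)
    (dsqerr act D (th + t *: h) h x).
Proof.
rewrite (_ : (fun s : R => _) = \sum_(i < ell L)
  (fun s : R => netN ell act (th + s *: h) x L i.+1 - ith (f x) i.+1) ^+ 2); last first.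
  by apply/funext => s; rewrite fct_sumE.
apply: is_derive_sum => i.
have dN := netN_is_derive ell act th h x L i.+1 t derivable_act.
have dR : is_derive t 1
    (fun s : R => netN ell act (th + s *: h) x L i.+1 - ith (f x) i.+1)
    (dnetN ell act D (th + t *: h) h x L i.+1).
  rewrite (_ : (fun s : R => _) = (fun s : R => netN ell act (th + s *: h) x L i.+1)
    - cst (ith (f x) i.+1)); last exact/funext.
  by apply: is_derive_eq; rewrite subr0.
by apply: is_derive_eq; rewrite expr1.
Qed.

(** Differentiation under the integral needs a majorant only for [s] near [t]; on [](t - 1), (t +
    1)[] the parameters stay bounded, so [sqerr_le_envelope] supplies it. *)
Lemma loss_is_derive th h (t : R) :
  is_derive t 1 (fun s : R => loss ell L mu a b act f (th + s *: h))
    (dloss act D (th + t *: h) h).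
Proof.
have mbx : measurable bx by exact: measurable_box.
(* The first two summands bound [th + s *: h] for [|s| <= |t| + 1], the last one bounds [h]. *)
pose K := `|th| + (`|t| + 1) * `|h| + `|h|.
have [c Hc] := sqerr_le_envelope C K.
pose F (s : R) x := sqerr ell L act (th + s *: h) f x.
have It : `](t - 1), (t + 1)[%classic t by rewrite /= in_itv/=; lra.
have iF s : `](t - 1), (t + 1)[%classic s -> mu.-integrable bx (EFin \o F s).
  by move=> _; exact: integrable_sqerr adm.
have dF s x : `](t - 1), (t + 1)[%classic s -> bx x -> derivable (F ^~ x) s 1.
  by move=> _ _; have [] := sqerr_is_derive th h x s.
have dFE s x : (partial1of2 F) s x = dsqerr act D (th + s *: h) h x.
  by rewrite partial1of2E; have [_] := sqerr_is_derive th h x s.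
have G0 x : 0 <= `|c| * envelope x.
  by rewrite mulr_ge0// (le_trans ler01)// envelope_ge1.
have iG : mu.-integrable bx (EFin \o (fun x => `|c| * envelope x)).
  exact: (integrableZl mbx `|c| integrable_envelope).
have dF_le s x : `](t - 1), (t + 1)[%classic s -> bx x ->
    `|(partial1of2 F) s x| <= `|c| * envelope x.
  rewrite /= in_itv/= => /andP[ts st] bxx; rewrite dFE.
  have [||_ H] := Hc act D (th + s *: h) h x adm _ _ bxx.
  - rewrite /K (le_trans (ler_normD _ _))// -addrA lerD// normrZ ler_wpDr//.
    rewrite ler_wpM2r//; have := ler_norm t; have := ler_norm (- t).
    rewrite normrN => ? ?; rewrite ler_norml; lra.
  - by rewrite lerDr addr_ge0// mulr_ge0// addr_ge0.
  - rewrite (le_trans H)// ler_wpM2r ?ler_norm// (le_trans ler01)//.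
    exact: envelope_ge1.
apply: DeriveDef.
  exact: (derivable_under_integral mbx It iF dF G0 iG dF_le).
rewrite -derive1E (differentiation_under_integral mbx It iF dF G0 iG dF_le).
by apply: eq_Rintegral => x _; rewrite dFE.
Qed.

Definition grad_loss th : 'rV[R]_d := \row_(p < d) dloss act D th (ebasis d p.+1).

(** Linearity in the direction passes through the integral because each coordinate integrand is
    integrable. The result is the form that [differentiable_of_directional] takes as input. *)
Lemma dlossE th h : dloss act D th h = dotv (grad_loss th) h.
Proof.
have mbx : measurable bx by exact: measurable_box.
have dsqerrE : dsqerr act D th h =
    fun x => \sum_(p < d) h 0 p * dsqerr act D th (ebasis d p.+1) x.
  apply/funext => x; under [RHS]eq_bigr do rewrite mulr_sumr.
  rewrite exchange_big/=; apply: eq_bigr => i _.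
  rewrite dnetN_sum mulr_sumr; apply: eq_bigr => p _; exact: mulrCA.
rewrite /dloss dsqerrE /dotv.
under [RHS]eq_bigr do rewrite mxE.
have int_e p : mu.-integrable bx (EFin \o dsqerr act D th (ebasis d p)).
  exact: integrable_dsqerr adm.
elim: (index_enum _) => [|p s IH].
  rewrite big_nil; under eq_Rintegral do rewrite big_nil.
  by rewrite Rintegral_cst// mul0r.
rewrite big_cons -IH -(RintegralZl _ mbx (int_e p.+1)).
rewrite -RintegralD//; first by apply: eq_Rintegral => x _; rewrite big_cons.
- by apply: (integrableZl mbx _ (int_e p.+1)).
- rewrite (_ : _ \o _ = fun x =>
    (\sum_(q <- s) (h 0 q)%:E * (dsqerr act D th (ebasis d q.+1) x)%:E)%E).
    by apply: integrable_sum => // q _; apply: (integrableZl mbx _ (int_e q.+1)).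
  by apply/funext => x; rewrite /= -sumEFin.
Qed.

Lemma grad_loss_coord_continuous p th : (fun u => grad_loss u 0 p) @ th --> grad_loss th 0 p.
Proof.
have cact m (y : nat -> R) l : (0 < m)%N -> y @ \oo --> l ->
    (fun n => act m (y n)) @ \oo --> act m l.
  move=> _ yl; apply: (cvg_comp y (act m) yl).
  by have /derivable1_diffP/differentiable_continuous := derivable_act m l.
apply: cvg_at_seq => u uth; under eq_fun do rewrite mxE.
rewrite mxE; apply: (loss_dloss_seq_cvg C (fun=> act) (fun=> D) _ _ u th _ _ uth cact _).2.
- exact: nearW.
- move=> x m j _.
  apply: (cvg_comp (fun n => netN ell act (u n) x m j) (D m)); last exact: continuous_D.
  exact: (netN_cvg ell _ _ (fun=> act) act u th x m j cact uth).
Qed.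

Lemma loss_differentiable th : differentiable (loss ell L mu a b act f) th /\
  forall h, 'D_h (loss ell L mu a b act f) th = dloss act D th h.
Proof.
have [||dL DL] := differentiable_of_directional _ _
    (loss ell L mu a b act f) grad_loss th.
- by move=> u h t; rewrite -dlossE; exact: loss_is_derive.
- by move=> p; exact: grad_loss_coord_continuous.
- by split => // h; rewrite DL dlossE.
Qed.

Lemma gradient_loss : gradient (loss ell L mu a b act f) = grad_loss.
Proof. by apply/funext => th; apply/rowP => p; rewrite !mxE (loss_differentiable th).2. Qed.

Lemma loss_C1 : C1 (loss ell L mu a b act f : 'rV[R]_d -> R).
Proof.
split=> [th|]; first exact: (loss_differentiable th).1.
rewrite gradient_loss => th; apply: (row_cvg _ _ _ (nbhs th)) => p.
exact: grad_loss_coord_continuous.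
Qed.

End differentiability.
End loss.

(** * Parameter indices and path expansions *)

Section parameter_indices.
Context (ell : nat -> nat).

Lemma dkS k : dk ell k.+1 = (dk ell k + ell k.+1 * (ell k + 1))%N.
Proof. by rewrite /dk big_nat_recr. Qed.

Lemma leq_dk k l : (k <= l)%N -> (dk ell k <= dk ell l)%N.
Proof.
move=> /subnKC <-; elim: (l - k)%N => [|m IH]; first by rewrite addn0.
by rewrite addnS dkS (leq_trans IH)// leq_addr.
Qed.

Definition weight_index (k i j : nat) : nat :=
  ((i - 1) * ell (k - 1) + j + dk ell (k - 1))%N.

Definition bias_index (k i : nat) : nat :=
  (ell k * ell (k - 1) + i + dk ell (k - 1))%N.

Lemma weight_index_bounds k i j : (0 < k)%N -> (0 < i <= ell k)%N ->
  (0 < j <= ell (k - 1))%N ->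
  (dk ell (k - 1) < weight_index k i j <= dk ell (k - 1) + ell k * ell (k - 1))%N.
Proof. rewrite /weight_index; case: i => // i _; nia. Qed.

Lemma bias_index_bounds k i : (0 < k)%N -> (0 < i <= ell k)%N ->
  (dk ell (k - 1) + ell k * ell (k - 1) < bias_index k i <= dk ell k)%N.
Proof. by case: k => // k _; rewrite dkS subn1 /bias_index subn1 /=; nia. Qed.

(** [dk] is monotone, so the index blocks of different layers are disjoint. *)
Lemma parameter_block k k' m : (0 < k)%N -> (0 < k')%N ->
  (dk ell (k - 1) < m <= dk ell k)%N -> (dk ell (k' - 1) < m <= dk ell k')%N ->
  k = k'.
Proof.
move=> k0 k'0 mk mk'; have [kk'|k'k|//] := ltngtP k k'.
- have : (dk ell k <= dk ell (k' - 1))%N by apply: leq_dk; lia.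
  lia.
- have : (dk ell k' <= dk ell (k - 1))%N by apply: leq_dk; lia.
  lia.
Qed.

Lemma weight_index_block k i j : (0 < k)%N -> (0 < i <= ell k)%N ->
  (0 < j <= ell (k - 1))%N ->
  (dk ell (k - 1) < weight_index k i j <= dk ell k)%N.
Proof.
move=> k0 ik jk; have := weight_index_bounds _ _ _ k0 ik jk.
by case: k k0 {ik jk} => // k _; rewrite dkS subn1 /=; nia.
Qed.

Lemma bias_index_block k i : (0 < k)%N -> (0 < i <= ell k)%N ->
  (dk ell (k - 1) < bias_index k i <= dk ell k)%N.
Proof. by move=> k0 ik; have := bias_index_bounds _ _ k0 ik; lia. Qed.

(** Equal positions lie in the block of a single layer, so [k = k']; inside it, uniqueness of
    division with remainder (remainders from [1] to [ell (k - 1)]) recovers [i] and [j]. *)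
Lemma weight_index_inj k i j k' i' j' : (0 < k)%N -> (0 < k')%N ->
  (0 < i <= ell k)%N -> (0 < j <= ell (k - 1))%N ->
  (0 < i' <= ell k')%N -> (0 < j' <= ell (k' - 1))%N ->
  (weight_index k i j == weight_index k' i' j') =
  [&& k == k', i == i' & j == j'].
Proof.
move=> k0 k'0 ik jk ik' jk'; apply/eqP/and3P => [E|[/eqP-> /eqP-> /eqP->]//].
have B := weight_index_block _ _ _ k0 ik jk.
have B' := weight_index_block _ _ _ k'0 ik' jk'.
rewrite -E in B'; have kk' := parameter_block _ _ _ k0 k'0 B B'.
rewrite -{}kk' in ik' jk' E *; move: {B B'} E; rewrite /weight_index => /addIn E.
have ii' : i = i' by case: i i' ik ik' E => [|i] [|i']// ik ik'; nia.
by rewrite -ii' in E *; split => //; apply/eqP; lia.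
Qed.

Lemma bias_index_inj k i k' i' : (0 < k)%N -> (0 < k')%N ->
  (0 < i <= ell k)%N -> (0 < i' <= ell k')%N ->
  (bias_index k i == bias_index k' i') = (k == k') && (i == i').
Proof.
move=> k0 k'0 ik ik'; apply/eqP/andP => [E|[/eqP-> /eqP->]//].
have B := bias_index_block _ _ k0 ik; have B' := bias_index_block _ _ k'0 ik'.
rewrite -E in B'; have kk' := parameter_block _ _ _ k0 k'0 B B'.
rewrite -kk' in E *; split => //; apply/eqP.
by move: E; rewrite /bias_index; lia.
Qed.

(** In each block all weights precede all biases. *)
Lemma weight_index_neq_bias_index k i j k' i' : (0 < k)%N -> (0 < k')%N ->
  (0 < i <= ell k)%N -> (0 < j <= ell (k - 1))%N -> (0 < i' <= ell k')%N ->
  (weight_index k i j == bias_index k' i') = false.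
Proof.
move=> k0 k'0 ik jk ik'; apply/negP => /eqP E.
have B := weight_index_block _ _ _ k0 ik jk; have B' := bias_index_block _ _ k'0 ik'.
rewrite -E in B'; have kk' := parameter_block _ _ _ k0 k'0 B B'.
have := weight_index_bounds _ _ _ k0 ik jk; have := bias_index_bounds _ _ k'0 ik'.
by rewrite E -kk'; lia.
Qed.

End parameter_indices.

(** Only genuine paths are ever evaluated, so the summands need to agree only where each [g m] is a
    neuron of layer [m]. *)
Lemma eq_pathsum_aux (R : nzRingType) (ell : nat -> nat) c k (F G : (nat -> nat) -> R) :
  (forall g, (forall m, (k <= m < k + c)%N -> (0 < g m <= ell m)%N) -> F g = G g) ->
  pathsum_aux ell c k F = pathsum_aux ell c k G.
Proof.
elim: c k F G => [|c IH] k F G FG /=; first by apply: FG => m; lia.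
apply: eq_bigr => v _; apply: IH => g gP; apply: FG => m mk.
by have [->|mk'] := eqVneq m k; [have := ltn_ord v; lia|apply: gP; lia].
Qed.

Lemma pathsum_aux_sum (R : nzRingType) (ell : nat -> nat) c k (I : Type) (s : seq I)
    (F : I -> (nat -> nat) -> R) :
  \sum_(v <- s) pathsum_aux ell c k (F v) =
  pathsum_aux ell c k (fun g => \sum_(v <- s) F v g).
Proof.
elim: c k F => [//|c IH] k F /=.
by rewrite exchange_big; apply: eq_bigr => u _; rewrite -IH.
Qed.

(* Iterating the recursion of [T] from level [k] to level [k + c] expands into
   a sum over all paths of neurons. *)
Lemma pathsum_unroll (R : comNzRingType) (ell : nat -> nat) c k
    (M : nat -> nat -> nat -> R) (T : nat -> nat -> R) (w : nat -> R) :
  (forall n u, (k <= n < k + c)%N -> (0 < u <= ell n.+1)%N ->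
     T n.+1 u = \sum_(v < ell n) M n.+1 u v.+1 * T n v.+1) ->
  pathsum_aux ell c.+1 k (fun g => T k (g k) * w (g (k + c)%N) *
    \prod_(k.+1 <= n < (k + c).+1) M n (g n) (g n.-1)) =
  \sum_(v < ell (k + c)%N) T (k + c)%N v.+1 * w v.+1.
Proof.
elim: c k => [|c IH] k TM.
  rewrite addn0 /=; apply: eq_bigr => v _.
  by rewrite eqxx big_geq ?mulr1.
(* The induction peels off the lowest layer [k]: the right side becomes the path sum from [k.+1] on,
   and both sides are compared path by path. *)
rewrite -addSnnS -IH; last by move=> n u nk; apply: TM; lia.
pose F (g : nat -> nat) := T k (g k) * w (g (k.+1 + c)%N) *
  \prod_(k.+1 <= n < (k.+1 + c).+1) M n (g n) (g n.-1).
pose F' (v : 'I_(ell k)) g := F (fun m => if m == k then v.+1 else g m).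
rewrite -[LHS]/(\sum_(v < ell k) pathsum_aux ell c.+1 k.+1 (F' v)).
rewrite pathsum_aux_sum /F' /F {F F'}.
apply: eq_pathsum_aux => g gP /=.
(* One use of the recursion at neuron [g k.+1] produces the sum over its predecessors [v] in layer
   [k]. *)
rewrite TM; [|lia|by apply: gP; lia].
rewrite !mulr_suml; apply: eq_bigr => v _.
rewrite eqxx [(k.+1 + c == k)%N](_ : _ = false); last lia.
rewrite big_ltn; last lia.
rewrite /= eqxx [(k.+1 == k)%N](_ : _ = false); last lia.
rewrite -!mulrA [RHS]mulrCA; congr (_ * _).
rewrite mulrCA; congr (_ * _); congr (_ * _).
rewrite !big_nat; apply: eq_bigr => n nk.
rewrite [(n == k)%N](_ : _ = false); last lia.
by rewrite [(n.-1 == k)%N](_ : _ = false); last lia.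
Qed.

(** Both claims share one induction, because adding the integrals requires integrability of the sums
    already collected. *)
Lemma Rintegral_pathsum_aux d (T : measurableType d) (R : realType)
    (mu : {measure set T -> \bar R}) (B : set T) (mB : measurable B)
    (ell : nat -> nat) c k (F : (nat -> nat) -> T -> R) :
  (forall g, mu.-integrable B (EFin \o F g)) ->
  mu.-integrable B (EFin \o (fun x => pathsum_aux ell c k (fun g => F g x))) /\
  pathsum_aux ell c k (fun g => Rintegral mu B (F g)) =
  Rintegral mu B (fun x => pathsum_aux ell c k (fun g => F g x)).
Proof.
elim: c k F => [|c IH] k F iF /=; first by split => //; exact: iF.
have {}IH v := IH k.+1 (fun g => F (fun w => if w == k then v.+1 else g w))
  (fun g => iF _).
elim: (index_enum _) => [|v s [IHi IHs]].
  split; last by rewrite big_nil; under eq_Rintegral do rewrite big_nil;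
    rewrite Rintegral_cst// mul0r.
  by rewrite (_ : _ \o _ = cst 0%E); [exact: integrable0|
    apply/funext => x /=; rewrite big_nil].
have [iv Ev] := IH v; split.
  rewrite (_ : _ \o _ = (EFin \o (fun x => pathsum_aux ell c k.+1
      (fun g => F (fun w => if w == k then v.+1 else g w) x))) \+
    (EFin \o (fun x => \sum_(v <- s) pathsum_aux ell c k.+1
      (fun g => F (fun w => if w == k then v.+1 else g w) x)))).
    exact: integrableD.
  by apply/funext => x; rewrite /= big_cons EFinD.
rewrite big_cons Ev IHs -RintegralD//.
by apply: eq_Rintegral => x _; rewrite big_cons.
Qed.

Section path_expansion.
Context {R : realType} {n0 d : nat} (ell : nat -> nat) (act D : nat -> R -> R)
  (th e : 'rV[R]_d) (x : 'rV[R]_n0) (L k i : nat) (s : R).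
Hypothesis kL : (0 < k <= L)%N.
(* The direction [e] only perturbs the parameters entering neuron [i] of layer [k]. *)
Hypothesis source : forall n u, (n < L)%N -> (0 < u <= ell n.+1)%N ->
  bias ell e n.+1 u +
    \sum_(j < ell n) wgt ell e n.+1 u j.+1 * layer_input ell act th x n j.+1 =
  if (n.+1 == k) && (u == i) then s else 0.

Lemma dnetN_source n u : (n < L)%N -> (0 < u <= ell n.+1)%N ->
  dnetN ell act D th e x n.+1 u =
  (if (n.+1 == k) && (u == i) then s else 0) +
  \sum_(j < ell n) wgt ell th n.+1 u j.+1 * D n (netN ell act th x n j.+1) *
    dnetN ell act D th e x n j.+1.
Proof.
move=> nL un; rewrite -source//= big_split addrA /=; congr (_ + _).
by apply: eq_bigr => j _; rewrite mulrA.
Qed.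

(** The formal derivative starts at [0] and meets no source before layer [k]. *)
Lemma dnetN_below n u : (n < k)%N -> (0 < u <= ell n)%N ->
  dnetN ell act D th e x n u = 0.
Proof.
elim: n u => [//|n IH] u nk un; rewrite dnetN_source//; last lia.
rewrite ltn_eqF// add0r big1// => j _; rewrite IH ?mulr0//; first exact: ltnW.
by have := ltn_ord j; lia.
Qed.

Lemma dnetN_at_layer u : (0 < u <= ell k)%N ->
  dnetN ell act D th e x k u = if u == i then s else 0.
Proof.
move=> uk; have [n nk] : exists n, k = n.+1 by exists k.-1; lia.
rewrite nk dnetN_source; [|lia|by rewrite -nk].
rewrite -nk eqxx /= big1 ?addr0// => j _; rewrite dnetN_below ?mulr0//; first lia.
by have := ltn_ord j; lia.
Qed.

(** Backpropagation: above layer [k] the recursion has no source, so it unrolls down to layer [k],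
    where the only nonzero starting value is [s] at neuron [i]. *)
Lemma dnetN_path (w : nat -> R) :
  \sum_(v < ell L) w v.+1 * dnetN ell act D th e x L v.+1 =
  pathsum ell k L (fun g => (if g k == i then s else 0) * w (g L) *
    \prod_(k.+1 <= n < L.+1)
      (wgt ell th n (g n) (g n.-1) * D n.-1 (netN ell act th x n.-1 (g n.-1)))).
Proof.
have kc : (k + (L - k) = L)%N by lia.
have TM n u : (k <= n < k + (L - k))%N -> (0 < u <= ell n.+1)%N ->
    dnetN ell act D th e x n.+1 u = \sum_(v < ell n)
      wgt ell th n.+1 u v.+1 * D n (netN ell act th x n v.+1) *
      dnetN ell act D th e x n v.+1.
  move=> nk un; rewrite dnetN_source//; last lia.
  by rewrite gtn_eqF ?add0r//; lia.
have := pathsum_unroll _ ell (L - k) k (fun n u v =>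
  wgt ell th n u v * D n.-1 (netN ell act th x n.-1 v)) (fun n u =>
  dnetN ell act D th e x n u) w TM.
rewrite kc; under eq_bigr do rewrite mulrC; move=> <-.
rewrite /pathsum subSn; last lia.
by apply: eq_pathsum_aux => g gk; rewrite dnetN_at_layer//; apply: gk; lia.
Qed.

End path_expansion.

(** * Coordinate derivatives of the loss as integrals over paths *)

Section loss_paths.
Context {R : realType} {L d : nat} {ell : nat -> nat} {a b : R}
  {mu : {measure set (BorelRV R (ell 0%N)) -> \bar R}}
  {f : BorelRV R (ell 0%N) -> 'rV[R]_(ell L)}.
Local Notation bx := (box (ell 0%N) a b).
Hypothesis mu_fin : (mu bx < +oo)%E.
Hypothesis mf : forall i : 'I_(ell L), measurable_fun bx (fun x => f x 0 i).
Hypothesis f2_fin :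
  (\int[mu]_(x in bx) (\sum_(i < ell L) ith (f x) i.+1 ^+ 2)%:E < +oo)%E.
Context (C : R) (act D : nat -> R -> R) (th : 'rV[R]_d).
Hypothesis adm : admissible C act D.
Hypothesis d_eq : d = dk ell L.

(** Common shape of the four integrands in the claims: [s] is the input of the neuron for a weight
    and [1] for a bias. *)
Definition path_integrand (s : BorelRV R (ell 0%N) -> R) (k i : nat) (g : nat -> nat)
    (x : BorelRV R (ell 0%N)) : R :=
  (if g k == i then s x else 0) * (2 * (netN ell act th x L (g L) - ith (f x) (g L))) *
  \prod_(k.+1 <= n < L.+1)
    (wgt ell th n (g n) (g n.-1) * D n.-1 (netN ell act th x n.-1 (g n.-1))).

Lemma integrable_path_integrand (s : BorelRV R (ell 0%N) -> R) (M : R) k i g :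
  measurable_fun bx s -> (forall x, bx x -> `|s x| <= M) ->
  mu.-integrable bx (EFin \o path_integrand s k i g).
Proof.
move=> ms sM.
have [M' M'0 HM'] := @netN_bounded R (ell 0%N) d ell (`|a| + `|b|) `|th| L.
(* Each factor is a weight, at most [|th|], times an activation derivative, at most [C]. *)
pose P : R := \prod_(k.+1 <= n < L.+1) (`|th| * C).
apply: (integrable_le_envelope mu_fin mf f2_fin (`|M| * (2 * (M' + 1)) * P)).
  apply: measurable_funM; first apply: measurable_funM.
  - by case: (g k == i) => //; exact: measurable_cst.
  - apply: measurable_funM; first exact: measurable_cst.
    exact: (measurable_residual mf _ _ _ _ _ adm).
  - apply: measurable_prod => n _; apply: measurable_funM; first exact: measurable_cst.
    apply: measurable_funTS; apply: measurableT_comp; first exact: measurable_D adm n.-1.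
    by apply: measurable_netN; exact: measurable_act adm.
move=> x bxx; have E1 := @envelope_ge1 R L ell f x; have E0 := le_trans ler01 E1.
have s_le : `|if g k == i then s x else 0| <= `|M|.
  case: ifP => _; last by rewrite normr0.
  exact: le_trans (sM x bxx) (ler_norm _).
have N_le : `|netN ell act th x L (g L) - ith (f x) (g L)| <= (M' + 1) * @envelope R L ell f x.
  rewrite (le_trans (ler_normB _ _))// mulrDl mul1r lerD//; last exact: ith_f_le_envelope.
  rewrite (@le_trans _ _ M')//; last by rewrite ler_peMr.
  by have [] := HM' act th x (g L) (act_le _ _ _ adm) (lexx _) (box_ith_le bxx).
have P_le : `|\prod_(k.+1 <= n < L.+1)
    (wgt ell th n (g n) (g n.-1) * D n.-1 (netN ell act th x n.-1 (g n.-1)))| <= P.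
  rewrite normr_prod; apply: ler_prod => n _; rewrite normr_ge0/= normrM.
  by rewrite ler_pM//; [exact: ith_norm|exact: D_le adm n.-1 _].
rewrite [leRHS](_ : _ =
  `|M| * (2 * ((M' + 1) * @envelope R L ell f x)) * P); last by ring.
rewrite /path_integrand !normrM (ger0_norm (ler0n R 2)).
have N0 : 0 <= 2 * `|netN ell act th x L (g L) - ith (f x) (g L)| by rewrite mulr_ge0.
by rewrite !ler_pM// ?mulr_ge0.
Qed.

Lemma dloss_path (e : 'rV[R]_d) (s : BorelRV R (ell 0%N) -> R) (M : R) k i :
  (0 < k <= L)%N -> measurable_fun bx s -> (forall x, bx x -> `|s x| <= M) ->
  (forall (x : 'rV[R]_(ell 0%N)) n u, (n < L)%N -> (0 < u <= ell n.+1)%N ->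
    bias ell e n.+1 u +
      \sum_(j < ell n) wgt ell e n.+1 u j.+1 * layer_input ell act th x n j.+1 =
    if (n.+1 == k) && (u == i) then s x else 0) ->
  @dloss R L d ell a b mu f act D th e =
  pathsum ell k L (fun g => Rintegral mu bx (path_integrand s k i g)).
Proof.
move=> kL ms sM source; have mbx : measurable bx by exact: measurable_box.
rewrite /pathsum; have [_ ->] := Rintegral_pathsum_aux _ _ _ mu _ mbx ell (L.+1 - k) k _
  (fun g => integrable_path_integrand s M k i g ms sM).
apply: eq_Rintegral => x _.
rewrite /dsqerr -[RHS]/(pathsum ell k L (fun g => path_integrand s k i g x)).
exact: (dnetN_path ell act D th e x L k i (s x) kL (source x)
  (fun v => 2 * (netN ell act th x L v - ith (f x) v))).
Qed.

Lemma dloss_weight k i j : (0 < k <= L)%N -> (0 < i <= ell k)%N ->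
  (0 < j <= ell (k - 1))%N ->
  @dloss R L d ell a b mu f act D th (ebasis d (weight_index ell k i j)) =
  pathsum ell k L (fun g => Rintegral mu bx
    (path_integrand (fun x => layer_input ell act th x (k - 1) j) k i g)).
Proof.
move=> kL ik jk; have k0 : (0 < k)%N by lia.
have [M _ HM] := @netN_bounded R (ell 0%N) d ell (`|a| + `|b|) `|th| (k - 1).
apply: (dloss_path _ _ M) => //.
- by apply: measurable_funTS; apply: measurable_layer_input; exact: measurable_act adm.
- move=> x bxx.
  by have [] := HM act th x j (act_le _ _ _ adm) (lexx _) (box_ith_le bxx).
- move=> x n u nL un.
  have rng m : (dk ell n < m <= dk ell n.+1)%N -> (0 < m <= d)%N.
    by have := leq_dk ell _ _ nL; rewrite d_eq; lia.
  have n1 : (n.+1 - 1 = n)%N by lia.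
  have -> : bias ell (ebasis d (weight_index ell k i j) : 'rV[R]_d) n.+1 u = 0.
    rewrite /bias -/(bias_index ell n.+1 u) ith_ebasis.
      by rewrite eq_sym weight_index_neq_bias_index.
    by apply: rng; have := bias_index_block ell n.+1 u isT un; rewrite n1.
  have wE (v : 'I_(ell n)) : wgt ell (ebasis d (weight_index ell k i j) : 'rV[R]_d)
      n.+1 u v.+1 = [&& n.+1 == k, u == i & v.+1 == j]%:R.
    have vn : (0 < v.+1 <= ell (n.+1 - 1))%N by rewrite n1 /=.
    rewrite /wgt -/(weight_index ell n.+1 u v.+1) ith_ebasis.
      by rewrite weight_index_inj.
    by apply: rng; have := weight_index_block ell n.+1 u v.+1 isT un vn; rewrite n1.
  rewrite add0r; under eq_bigr do rewrite wE.
  have [nk|nk] := eqVneq n.+1 k; last by rewrite big1// => v _; rewrite mul0r.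
  have [ui|ui] := eqVneq u i; last by rewrite big1// => v _; rewrite mul0r.
  have kn : (k - 1 = n)%N by lia.
  have jn : (j.-1 < ell n)%N by rewrite kn in jk; lia.
  have j1 : j.-1.+1 = j by lia.
  (* Neuron [j] is the ordinal [j.-1]; it alone survives, leaving the layer input [j] as source. *)
  rewrite (bigD1 (Ordinal jn))//= j1 eqxx mul1r kn big1 ?addr0// => v vj.
  rewrite [(v.+1 == j)%N](_ : _ = false) ?mul0r//.
  by apply/negP => /eqP vj'; case/negP: vj; apply/eqP/val_inj => /=; lia.
Qed.

Lemma dloss_bias k i : (0 < k <= L)%N -> (0 < i <= ell k)%N ->
  @dloss R L d ell a b mu f act D th (ebasis d (bias_index ell k i)) =
  pathsum ell k L (fun g => Rintegral mu bx (path_integrand (fun=> 1) k i g)).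
Proof.
move=> kL ik; have k0 : (0 < k)%N by lia.
apply: (dloss_path _ _ 1) => //.
- by move=> x _; rewrite normr1.
- move=> x n u nL un.
  have rng m : (dk ell n < m <= dk ell n.+1)%N -> (0 < m <= d)%N.
    by have := leq_dk ell _ _ nL; rewrite d_eq; lia.
  have n1 : (n.+1 - 1 = n)%N by lia.
  have -> : bias ell (ebasis d (bias_index ell k i) : 'rV[R]_d) n.+1 u =
      ((n.+1 == k) && (u == i))%:R.
    rewrite /bias -/(bias_index ell n.+1 u) ith_ebasis ?bias_index_inj//.
    by apply: rng; have := bias_index_block ell n.+1 u isT un; rewrite n1.
  rewrite big1 ?addr0; first by case: ifP.
  move=> v _; rewrite /wgt -/(weight_index ell n.+1 u v.+1).
  have vn : (0 < v.+1 <= ell (n.+1 - 1))%N by rewrite n1 /=.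
  rewrite ith_ebasis; first by rewrite weight_index_neq_bias_index// mul0r.
  by apply: rng; have := weight_index_block ell n.+1 u v.+1 isT un vn; rewrite n1.
Qed.

End loss_paths.

(** * The ReLU limit *)

Section powers.
Context {R : realType}.
Implicit Types r p e : R.

Lemma powR_ge1 r p : 1 <= r -> 0 <= p -> 1 <= r `^ p.
Proof. by move=> r1 p0; rewrite -[leLHS](powRr0 r) ler_powR. Qed.

Lemma near_pinfty_powR_gt p (M : R) : 0 < p -> \forall r \near +oo, M < r `^ p.
Proof.
move=> p0; near=> r.
have M1 : 0 < `|M| + 1 by rewrite ltr_wpDl.
have rM : (`|M| + 1) `^ p^-1 < r by near: r; apply: nbhs_pinfty_gt; exact: num_real.
have r0 : 0 < r by apply: lt_trans rM; exact: powR_gt0.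
apply: (@lt_trans _ _ (`|M| + 1)); first by rewrite (le_lt_trans (ler_norm M))// ltrDl.
rewrite -[ltLHS](@powRr1 _ (`|M| + 1)); last exact: ltW.
rewrite -[X in _ `^ X < _](mulVf (lt0r_neq0 p0)) powRrM.
by apply: gt0_ltr_powR => //; rewrite nnegrE ?powR_ge0// ltW.
Unshelve. all: by end_near. Qed.

(** The rate belongs to layer [k.+1]. It is [0] for [k = 0] because the first layer precedes every
    activation. *)
Definition error_rate (k : nat) r : R := if k is 0%N then 0 else (r `^ k%:R^-1)^-1.

Lemma error_rate_ge0 k r : 0 <= error_rate k r.
Proof. by case: k => [|k]//=; rewrite invr_ge0 powR_ge0. Qed.

Lemma error_rate_leS k r : 1 <= r -> error_rate k r <= error_rate k.+1 r.
Proof.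
move=> r1; case: k => [|k]; first by rewrite [leLHS]/= error_rate_ge0.
have r0 : 0 < r by exact: lt_le_trans r1.
rewrite /= lef_pV2 ?posrE ?powR_gt0// ler_powR//.
by rewrite lef_pV2 ?posrE ?ltr0n// ler_nat.
Qed.

Lemma error_rate_near k (K e : R) : 0 < e -> \forall r \near +oo, K * error_rate k r < e.
Proof.
move=> e0; case: k => [|k]; first by near=> r; rewrite mulr0.
near=> r; have r0 : 0 < r by near: r; apply: nbhs_pinfty_gt; exact: num_real.
rewrite /= ltr_pdivrMr ?powR_gt0// mulrC -ltr_pdivrMr//.
by near: r; apply: near_pinfty_powR_gt; rewrite invr_gt0 ltr0n.
Unshelve. all: by end_near. Qed.

(** The exponents [1/k] strictly decrease, so the quotient of consecutive rates tends to [0] and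
    beats any constants; for [k = 0] the left side is [0]. This decides the case of a neuron exactly
    at the kink. *)
Lemma error_rate_ltS k (K e : R) : 0 < e ->
  \forall r \near +oo, K * error_rate k r < e * error_rate k.+1 r.
Proof.
move=> e0; case: k => [|k].
  near=> r; have r0 : 0 < r by near: r; apply: nbhs_pinfty_gt; exact: num_real.
  by rewrite mulr0 mulr_gt0//= invr_gt0 powR_gt0.
pose p : R := k.+1%:R^-1; pose q : R := k.+2%:R^-1.
have qp : 0 < p - q by rewrite subr_gt0 ltf_pV2 ?posrE ?ltr0n// ltr_nat.
near=> r; have r0 : 0 < r by near: r; apply: nbhs_pinfty_gt; exact: num_real.
rewrite /= -/p -/q.
have -> : r `^ p = r `^ (p - q) * r `^ q.
  by rewrite -powRD ?subrK// (lt0r_neq0 r0) implybT.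
rewrite invfM mulrA ltr_pM2r ?invr_gt0 ?powR_gt0//.
rewrite ltr_pdivrMr ?powR_gt0// mulrC -ltr_pdivrMr//.
by near: r; exact: near_pinfty_powR_gt.
Unshelve. all: by end_near. Qed.

End powers.

(** The upper limit is an infimum of suprema over sets of the filter; testing it on the set where
    [F r <= e] bounds it by [e]. *)
Lemma limf_esup_eq0 (R : realType) (F : R -> R) : (forall r, 0 <= F r) ->
  F @ +oo --> (0 : R) ->
  limf_esup (fun r => (F r)%:E) (@pinfty_nbhs R) = (0 : R)%:E.
Proof.
move=> F0 cF; apply/eqP; rewrite eq_le; apply/andP; split.
  apply/lee_addgt0Pr => e e0; rewrite add0e limf_esupE.
  have Fe : \forall r \near +oo, F r <= e.
    have cFe : \forall r \near +oo, `|F r - 0| <= e by move/cvgrPdistC_le : cF; apply.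
    near=> r; apply: (le_trans (ler_norm _)); rewrite -[F r]subr0.
    by near: r; exact: cFe.
  apply: (@le_trans _ _ (ereal_sup ((fun r => (F r)%:E) @` [set r | F r <= e]))).
    by apply: ereal_inf_lbound; exists [set r | F r <= e].
  by apply: ge_ereal_sup => _ [r Fr <-]; rewrite lee_fin.
apply: limf_esup_ge0; last by move=> r; rewrite lee_fin.
exact: filter_not_empty.
Unshelve. all: by end_near. Qed.

(** Derivative of the ReLU with value [0] at the kink, matching the strict inequality in [Xset]. *)
Definition step {R : realType} (m : nat) (y : R) : R := (0 < y)%R%:R.

Section relu_limit.
Context {R : realType} (Rr : R -> R -> R) (A B C : R).
Hypothesis A0 : 0 < A.
Hypothesis AB : A < B.
Hypothesis Rr_C1 : forall r, 1 <= r ->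
  (forall x, derivable (Rr r) x 1) /\ continuous (derive1 (Rr r)).
Hypothesis Rr_eq0 : forall r x, 1 <= r -> x <= A / r -> Rr r x = 0.
Hypothesis Rr_bounds : forall r y, 1 <= r -> 0 <= Rr r y <= Num.max y 0.
Hypothesis Rr_id : forall r z, 1 <= r -> B / r <= z -> Rr r z = z.
Hypothesis Rr_derive_le : forall r x, 1 <= r -> `|derive1 (Rr r) x| <= C.

Implicit Types r y z : R.

Let D (r : R) (m : nat) := derive1 (act_r Rr r m).

(** Holds for [m = 0] too, as [0^-1 = 0] makes the power equal to [1]; hence the assumptions on [Rr]
    reach [act_r] at every layer index. *)
Lemma powR_invn_ge1 r m : 1 <= r -> 1 <= r `^ m%:R^-1.
Proof. by move=> r1; rewrite powR_ge1// invr_ge0. Qed.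

Lemma derivable_act_r r m y : 1 <= r -> derivable (act_r Rr r m) y 1.
Proof. by move=> r1; have [] := Rr_C1 _ (powR_invn_ge1 _ m r1). Qed.

Lemma continuous_D_act_r r m : 1 <= r -> continuous (D r m).
Proof. by move=> r1; have [] := Rr_C1 _ (powR_invn_ge1 _ m r1). Qed.

Lemma admissible_act_r r : 1 <= r -> admissible C (act_r Rr r) (D r).
Proof.
move=> r1; split=> [m y|m y|m|m].
- have /andP[R0 Rm] := Rr_bounds _ y (powR_invn_ge1 _ m r1).
  by rewrite ger0_norm// (le_trans Rm)// ge_max ler_norm normr_ge0.
- exact/Rr_derive_le/powR_invn_ge1.
- apply: continuous_measurable_fun => y.
  by have /derivable1_diffP/differentiable_continuous := derivable_act_r r m y r1.
- by apply: continuous_measurable_fun; exact: continuous_D_act_r.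
Qed.

Lemma reluE (y : R) : relu y = (y + `|y|) / 2.
Proof. by rewrite /relu maxr_absE subr0 addr0. Qed.

Lemma admissible_act_inf : admissible 1 (@act_inf R) step.
Proof.
split=> [m y|m y|m|m].
- have := ler_norm y; have := ler_norm (- y); rewrite normrN /act_inf reluE.
  by move=> ? ?; rewrite ger0_norm; lra.
- by rewrite /step; case: (0 < y); rewrite ?normr0 ?normr1.
- apply: continuous_measurable_fun => y; rewrite /act_inf.
  rewrite (_ : relu = fun z => (z + `|z|) / 2); last by apply/funext => z; exact: reluE.
  apply: cvgMr_tmp; apply: cvgD; first exact: cvg_id.
  exact: norm_continuous.
- rewrite /step (_ : (fun y => _) = \1_`]0, +oo[%classic); last first.
    by apply/funext => y; rewrite indicE mem_setE in_itv/= andbT.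
  by apply: measurable_indic; exact: measurable_itv.
Qed.

Lemma relu_lipschitz (y z : R) : `|relu y - relu z| <= `|y - z|.
Proof.
rewrite !reluE -mulrBl normrM [`|2^-1|]ger0_norm ?invr_ge0//.
rewrite ler_pdivrMr// opprD addrACA (le_trans (ler_normD _ _))//.
by rewrite mulr_natr mulr2n lerD// ler_dist_dist.
Qed.

(** [Rr r] equals the ReLU from [B / r] on and lies between [0] and the ReLU below, which gives the
    term [B / r]; the ReLU is 1-Lipschitz, which gives the other. *)
Lemma Rr_relu_le r y z : 1 <= r -> `|Rr r y - relu z| <= B / r + `|y - z|.
Proof.
move=> r1; have r0 : 0 < r by exact: lt_le_trans r1.
rewrite -(subrK (relu y) (Rr r y)) -addrA (le_trans (ler_normD _ _))//.
apply: lerD (relu_lipschitz _ _).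
have Br : 0 <= B / r by rewrite divr_ge0 ?ltW// (lt_trans A0).
have /andP[R0 Rm] := Rr_bounds _ y r1; rewrite -/(relu y) in Rm.
have [yB|By] := ltP y (B / r).
  rewrite ler0_norm ?subr_le0// opprB (le_trans (y := relu y)) ?gerBl//.
  by rewrite /relu ge_max Br ltW.
by rewrite Rr_id// /relu max_l ?subrr ?normr0// (le_trans Br).
Qed.

Lemma derive1_Rr_gt r y : 1 <= r -> B / r < y -> derive1 (Rr r) y = 1.
Proof.
move=> r1 By; rewrite derive1E (@near_eq_derive _ _ _ _ id) ?derive_id//.
near=> z; apply: Rr_id => //; apply: ltW; near: z; exact: lt_nbhsr.
Unshelve. all: by end_near. Qed.

Lemma derive1_Rr_lt r y : 1 <= r -> y < A / r -> derive1 (Rr r) y = 0.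
Proof.
move=> r1 yA; rewrite derive1E (@near_eq_derive _ _ _ _ (cst 0)) ?derive_cst//.
near=> z; apply: Rr_eq0 => //; apply: ltW; near: z; exact: lt_nbhsl.
Unshelve. all: by end_near. Qed.

Section network.
Context {n0 d : nat} (ell : nat -> nat) (th : 'rV[R]_d) (x : 'rV[R]_n0).
Local Notation N r := (netN ell (act_r Rr r) th x).
Local Notation Ninf := (netN ell act_inf th x).

(* The last activation applied, [Rr s] with [s = r^(1/k)], differs from the ReLU
   by at most [B / s], which dominates the errors of the earlier layers. *)
Lemma netN_error k : exists2 K : R, 0 <= K &
  forall r i, 1 <= r -> `|N r k.+1 i - Ninf k.+1 i| <= K * error_rate k r.
Proof.
elim: k => [|k [K K0 IH]].
  by exists 0 => // r i r1; rewrite /= subrr normr0 mulr0.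
exists ((ell k.+1)%:R * (`|th| * (B + K))) => [|r i r1].
  by rewrite !mulr_ge0// addr_ge0// ltW// (lt_trans A0).
rewrite [N r _ _]netNS [Ninf _ _]netNS opprD addrACA subrr add0r -sumrB.
rewrite (le_trans (ler_norm_sum _ _ _))//.
rewrite -mulrA -[X in X%:R]card_ord mulr_natl -sumr_const.
apply: ler_sum => j _; rewrite -mulrBr normrM -mulrA; apply: ler_pM => //.
  exact: ith_norm.
rewrite (le_trans (Rr_relu_le _ _ _ (powR_invn_ge1 _ k.+1 r1)))//.
rewrite mulrDl lerD// (le_trans (IH _ _ r1))// ler_wpM2l//.
exact: error_rate_leS.
Qed.

(** The derivative is eventually equal to its limit: in each sign case of the limit value [y], the
    neuron ends up beyond [B] or below [A] times [error_rate k.+1 r]. *)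
Lemma D_netN_cvg k i : (0 < k)%N ->
  (fun r => D r k (N r k i)) @ +oo --> step k (Ninf k i).
Proof.
case: k => // k _; have [K K0 HK] := netN_error k.
apply: cvg_near_cst; set y := Ninf k.+1 i.
have DE r : D r k.+1 = derive1 (Rr (r `^ k.+1%:R^-1)) by [].
have rateE r (z : R) : z / r `^ k.+1%:R^-1 = z * error_rate k.+1 r by [].
have Nb r : 1 <= r -> y - K * error_rate k r <= N r k.+1 i <= y + K * error_rate k r.
  by move=> r1; have := HK r i r1; rewrite -/y ler_norml => /andP[? ?]; lra.
have near_ge1 : \forall r \near +oo, (1 : R) <= r by apply: nbhs_pinfty_ge; exact: num_real.
rewrite /step; have [y0|y0|y0] := ltgtP 0 y.
(* Half of [y] absorbs the network error, the other half exceeds the threshold where the activation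
   becomes the identity. *)
- have y2 : 0 < y / 2 by rewrite divr_gt0.
  near=> r; have r1 : 1 <= r by near: r.
  rewrite DE derive1_Rr_gt ?powR_invn_ge1// rateE; have := Nb _ r1.
  have : K * error_rate k r < y / 2 by near: r; exact: (error_rate_near k K _ y2).
  have : B * error_rate k.+1 r < y / 2 by near: r; exact: (error_rate_near k.+1 B _ y2).
  lra.
- have ny0 : 0 < - y by rewrite oppr_gt0.
  near=> r; have r1 : 1 <= r by near: r.
  rewrite DE derive1_Rr_lt ?powR_invn_ge1//; have := Nb _ r1.
  have : K * error_rate k r < - y by near: r; exact: (error_rate_near k K _ ny0).
  have : 0 < A / r `^ k.+1%:R^-1.
    by rewrite divr_gt0// (lt_le_trans ltr01)// powR_invn_ge1.
  lra.
(* At the kink the value of the neuron is at most the error, which [error_rate_ltS] puts below the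
   cut-off of the next rate. *)
- near=> r; have r1 : 1 <= r by near: r.
  rewrite DE derive1_Rr_lt ?powR_invn_ge1// rateE; have := Nb _ r1.
  have : K * error_rate k r < A * error_rate k.+1 r.
    by near: r; exact: (error_rate_ltS k K _ A0).
  lra.
Unshelve. all: by end_near. Qed.

End network.

Lemma act_r_cvg (u y : nat -> R) l m : (0 < m)%N -> u @ \oo --> +oo ->
  y @ \oo --> l -> (fun n => act_r Rr (u n) m (y n)) @ \oo --> act_inf m l.
Proof.
case: m => // m _ uoo yl; apply/cvgrPdistC_le => e e0.
have e2 : 0 < e / 2 by rewrite divr_gt0.
have yle : \forall n \near \oo, `|y n - l| <= e / 2 by move/cvgrPdistC_le : yl; apply.
have ratele : \forall n \near \oo, B * error_rate m.+1 (u n) < e / 2.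
  exact: (uoo _ (error_rate_near m.+1 B _ e2)).
near=> n; have u1 : 1 <= u n by near: n; move/cvgryPge : uoo; exact.
rewrite (le_trans (Rr_relu_le _ _ _ (powR_invn_ge1 _ m.+1 u1)))// [leRHS]splitr.
by rewrite lerD//; [apply: ltW; near: n|near: n].
Unshelve. all: by end_near. Qed.

End relu_limit.

(** At the zero parameter the loss is the integral of [|f|^2], so finiteness of the loss there makes
    [f] square integrable. *)
Lemma netN_theta0 (R : realType) n0 d (ell : nat -> nat) (act : nat -> R -> R)
    (x : 'rV[R]_n0) k i : netN ell act (0 : 'rV[R]_d) x k i = 0.
Proof.
have ith0 m : ith (0 : 'rV[R]_d) m = 0 by rewrite -(scale0r 0) ithZ mul0r.
case: k => //= k; rewrite /bias ith0 add0r big1// => j _.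
by rewrite /wgt ith0 mul0r.
Qed.

Lemma enorm_ge0 (R : realType) d (v : 'rV[R]_d) : 0 <= enorm v.
Proof. exact: sqrtr_ge0. Qed.

Lemma enorm_cvg0 (R : realType) d (T : Type) (F : set_system T) {FF : Filter F}
    (u : T -> 'rV[R]_d) (l : 'rV[R]_d) :
  u @ F --> l -> (fun t => enorm (u t - l)) @ F --> (0 : R).
Proof.
move=> ul.
have coord0 p : (fun t => (u t - l) 0 p ^+ 2) @ F --> (0 : R) ^+ 2.
  apply: (cvg_comp (fun t => (u t - l) 0 p) (fun y : R => y ^+ 2)); last first.
    exact: exprn_continuous.
  under eq_fun do rewrite !mxE -ithS; rewrite -(subrr (ith l p.+1)) -ithS.
  by apply: cvgB; [exact: ith_cvg|exact: cvg_cst].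
have sum0 : (fun t => \sum_(p < d) (u t - l) 0 p ^+ 2) @ F -->
    \sum_(p < d) (0 : R) ^+ 2.
  by apply: cvgr_sum => p _; exact: coord0.
rewrite -[(0 : R)]sqrtr0 (_ : 0 = \sum_(p < d) (0 : R) ^+ 2); last first.
  by rewrite big1// => p _; rewrite expr0n.
by apply: (cvg_comp _ Num.sqrt sum0); exact: sqrt_continuous.
Qed.

(** * The claimed right-hand sides in terms of path integrands *)

Section rhs_paths.
Context {R : realType} {L d : nat} {ell : nat -> nat} {a b : R}
  {mu : {measure set (BorelRV R (ell 0%N)) -> \bar R}}
  {f : BorelRV R (ell 0%N) -> 'rV[R]_(ell L)} (th : 'rV[R]_d).
Local Notation bx := (box (ell 0%N) a b).

Lemma path_prod_inf (x : BorelRV R (ell 0%N)) g k : bx x ->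
  prod_inf ell L a b th x g k = \prod_(k.+1 <= n < L.+1)
    (wgt ell th n (g n) (g n.-1) * step n.-1 (netN ell act_inf th x n.-1 (g n.-1))).
Proof.
move=> bxx; apply: eq_bigr => n _; congr (_ * _); rewrite indicE /step.
congr (nat_of_bool _)%:R; apply/idP/idP; first by rewrite inE => -[].
by move=> N0; rewrite inE.
Qed.

(** The index [maxn (k - 1) 1] only keeps the activation term meaningful at [k = 1], where its
    indicator removes it. *)
Lemma layer_inputE (act : nat -> R -> R) (x : 'rV[R]_(ell 0%N)) k j : (0 < k <= L)%N ->
  layer_input ell act th x (k - 1) j =
  act (maxn (k - 1) 1) (netN ell act th x (maxn (k - 1) 1) j) * ind (1 < k <= L)%N +
  ith x j * ind (k == 1%N).
Proof.
case: k => [|[|k]]// kL; rewrite /ind.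
  by rewrite ltnn/= mulr0 mulr1 add0r.
rewrite [(_ && _)%N](_ : _ = true) ?[(k.+2 == 1)%N]/=; last by [].
by rewrite mulr1 mulr0 addr0 subn1 /= (maxn_idPl _).
Qed.

Lemma rhsW_r_path Rr r k i j : (0 < k <= L)%N ->
  rhsW_r ell L mu a b Rr f th r k i j =
  pathsum ell k L (fun g => Rintegral mu bx (@path_integrand R L d ell f (act_r Rr r)
    (fun m => derive1 (act_r Rr r m)) th
    (fun x => layer_input ell (act_r Rr r) th x (k - 1) j) k i g)).
Proof.
move=> kL; apply: eq_pathsum_aux => g _; apply: eq_Rintegral => x _.
rewrite /path_integrand layer_inputE// /ind.
by case: (g k == i); rewrite ?mulr0 ?mul0r// mulr1 -!mulrA mulrCA.
Qed.

Lemma rhsB_r_path Rr r k i :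
  rhsB_r ell L mu a b Rr f th r k i =
  pathsum ell k L (fun g => Rintegral mu bx (@path_integrand R L d ell f (act_r Rr r)
    (fun m => derive1 (act_r Rr r m)) th (fun=> 1) k i g)).
Proof.
apply: eq_pathsum_aux => g _; apply: eq_Rintegral => x _.
rewrite /path_integrand /ind.
by case: (g k == i); rewrite ?mulr0 ?mul0r// mulr1 mul1r.
Qed.

Lemma rhsW_inf_path k i j : (0 < k <= L)%N ->
  rhsW_inf ell L mu a b f th k i j =
  pathsum ell k L (fun g => Rintegral mu bx (@path_integrand R L d ell f act_inf
    step th (fun x => layer_input ell act_inf th x (k - 1) j) k i g)).
Proof.
move=> kL; apply: eq_pathsum_aux => g _; apply: eq_Rintegral => x /set_mem bxx.
rewrite path_prod_inf// /path_integrand layer_inputE// /ind.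
by case: (g k == i); rewrite ?mulr0 ?mul0r// mulr1 -!mulrA mulrCA.
Qed.

Lemma rhsB_inf_path k i :
  rhsB_inf ell L mu a b f th k i =
  pathsum ell k L (fun g => Rintegral mu bx (@path_integrand R L d ell f act_inf
    step th (fun=> 1) k i g)).
Proof.
apply: eq_pathsum_aux => g _; apply: eq_Rintegral => x /set_mem bxx.
rewrite path_prod_inf// /path_integrand /ind.
by case: (g k == i); rewrite ?mulr0 ?mul0r// mulr1 mul1r.
Qed.

End rhs_paths.

(** * Passage to the limit and assembly of the six claims *)

Theorem theorem2p9 (R : realType) (L d : nat) (ell : nat -> nat) (a b A B : R)
  (Rr : R -> R -> R)
  (mu : {measure set (BorelRV R (ell 0%N)) -> \bar R})
  (f : BorelRV R (ell 0%N) -> 'rV[R]_(ell L))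
  (G : 'rV[R]_d -> 'rV[R]_d) (theta : 'rV[R]_d) :
  (1 <= L)%N ->
  (forall k, (0 < ell k)%N) ->
  d = dk ell L ->
  a < b -> 0 < A -> A < B ->
  (* each R_r, r in [1,oo), is C^1 *)
  (forall r, 1 <= r ->
     (forall x, derivable (Rr r) x 1) /\ continuous (derive1 (Rr r))) ->
  (forall r x, 1 <= r -> x <= A / r -> Rr r x = 0) ->
  (forall r y, 1 <= r -> 0 <= Rr r y <= Num.max y 0) ->
  (forall r z, 1 <= r -> B / r <= z -> Rr r z = z) ->
  (exists C : R, forall r x, 1 <= r -> `|derive1 (Rr r) x| <= C) ->
  (* mu is a finite measure on [a,b]^{ell_0} *)
  (mu (box (ell 0%N) a b) < +oo)%E ->
  (* f is measurable *)
  (forall i : 'I_(ell L), measurable_fun (box (ell 0%N) a b) (fun x => f x 0 i)) ->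
  (* the loss integrals are real numbers *)
  (forall th : 'rV[R]_d,
     (forall r, 1 <= r ->
        (\int[mu]_(x in box (ell 0%N) a b) (sqerr ell L (act_r Rr r) th f x)%:E < +oo)%E)
     /\ (\int[mu]_(x in box (ell 0%N) a b) (sqerr ell L act_inf th f x)%:E < +oo)%E) ->
  (* G is the limit of the gradients whenever it exists *)
  (forall th : 'rV[R]_d,
     cvg ((fun r => gradient (loss ell L mu a b (act_r Rr r) f) th) @ +oo) ->
     G th = lim ((fun r => gradient (loss ell L mu a b (act_r Rr r) f) th) @ +oo)) ->
  (* (i) *)
      (forall r, 1 <= r -> C1 (fun th : 'rV[R]_d => loss ell L mu a b (act_r Rr r) f th)) /\
      (* (ii) *)
      (forall r k i j, 1 <= r -> (1 <= k <= L)%N -> (1 <= i <= ell k)%N ->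
         (1 <= j <= ell (k - 1))%N ->
         derive (loss ell L mu a b (act_r Rr r) f) theta
           (ebasis d ((i - 1) * ell (k - 1) + j + dk ell (k - 1))%N)
         = rhsW_r ell L mu a b Rr f theta r k i j) /\
      (* (iii) *)
      (forall r k i, 1 <= r -> (1 <= k <= L)%N -> (1 <= i <= ell k)%N ->
         derive (loss ell L mu a b (act_r Rr r) f) theta
           (ebasis d (ell k * ell (k - 1) + i + dk ell (k - 1))%N)
         = rhsB_r ell L mu a b Rr f theta r k i) /\
      (* (iv) *)
      limf_esup (fun r : R =>
          (`|loss ell L mu a b (act_r Rr r) f theta - loss ell L mu a b act_inf f theta|
           + enorm (gradient (loss ell L mu a b (act_r Rr r) f) theta - G theta))%:E)
        (@pinfty_nbhs R) = (0 : R)%:E /\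
      (* (v) *)
      (forall k i j, (1 <= k <= L)%N -> (1 <= i <= ell k)%N ->
         (1 <= j <= ell (k - 1))%N ->
         ith (G theta) ((i - 1) * ell (k - 1) + j + dk ell (k - 1))%N
         = rhsW_inf ell L mu a b f theta k i j) /\
      (* (vi) *)
      (forall k i, (1 <= k <= L)%N -> (1 <= i <= ell k)%N ->
         ith (G theta) (ell k * ell (k - 1) + i + dk ell (k - 1))%N
         = rhsB_inf ell L mu a b f theta k i).
Proof.
move=> L1 ell_gt0 d_eq ab A0 AB Rr_C1 Rr_eq0 Rr_bounds Rr_id [C Rr_derive_le].
move=> mu_fin mf loss_fin G_lim.
(* Square integrability of [f] is read off from the loss at the zero parameter. *)
have f2_fin : (\int[mu]_(x in box (ell 0%N) a b)
    (\sum_(i < ell L) ith (f x) i.+1 ^+ 2)%:E < +oo)%E.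
  have [_] := loss_fin 0; congr (_ < _)%E; apply: eq_integral => x _.
  congr EFin; apply: eq_bigr => i _.
  by rewrite netN_theta0 sub0r sqrrN.
have adm r (r1 : 1 <= r) := admissible_act_r Rr C Rr_C1 Rr_bounds Rr_derive_le r r1.
have derivable_act r (r1 : 1 <= r) m y := derivable_act_r Rr Rr_C1 r m y r1.
have continuous_D r (r1 : 1 <= r) m := continuous_D_act_r Rr Rr_C1 r m r1.
pose D r m := derive1 (act_r Rr r m).
have dL r (r1 : 1 <= r) h :
    'D_h (loss ell L mu a b (act_r Rr r) f) theta =
    @dloss R L d ell a b mu f (act_r Rr r) (D r) theta h.
  exact: (loss_differentiable mu_fin mf f2_fin C _ (adm r r1) (derivable_act r r1)
    (continuous_D r r1) theta).2.
have near_ge1 : \forall r \near +oo, (1 : R) <= r by apply: nbhs_pinfty_ge; exact: num_real.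
(* The limit [r -> oo] is taken along arbitrary sequences, where dominated convergence applies. *)
have seq_cvg h (u : nat -> R) : u @ \oo --> +oo ->
    (fun n => loss ell L mu a b (act_r Rr (u n)) f theta) @ \oo -->
      loss ell L mu a b act_inf f theta /\
    (fun n => @dloss R L d ell a b mu f (act_r Rr (u n)) (D (u n)) theta h) @ \oo -->
      @dloss R L d ell a b mu f act_inf step theta h.
  move=> uoo; apply: (loss_dloss_seq_cvg mu_fin mf f2_fin C (fun n => act_r Rr (u n))
    (fun n => D (u n)) act_inf step (fun=> theta)).
  - have u1 : \forall n \near \oo, 1 <= u n by exact: (uoo _ near_ge1).
    by near=> n; apply: adm; near: n.
  - exact: cvg_cst.
  - by move=> m y l m0; exact: (act_r_cvg Rr A B).
  - move=> x m j m0; apply: (cvg_comp u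
      (fun r => D r m (netN ell (act_r Rr r) theta x m j)) uoo).
    exact: (D_netN_cvg Rr A B).
have loss_cvg : (fun r => loss ell L mu a b (act_r Rr r) f theta) @ +oo -->
    loss ell L mu a b act_inf f theta.
  by apply/cvg_pinftyP => u /(seq_cvg 0)[].
have dloss_cvg h : (fun r => @dloss R L d ell a b mu f (act_r Rr r) (D r) theta h) @ +oo -->
    @dloss R L d ell a b mu f act_inf step theta h.
  by apply/cvg_pinftyP => u /(seq_cvg h)[].
pose grad_inf : 'rV[R]_d :=
  \row_p @dloss R L d ell a b mu f act_inf step theta (ebasis d p.+1).
have grad_cvg : (fun r => gradient (loss ell L mu a b (act_r Rr r) f) theta) @ +oo --> grad_inf.
  (* The partial derivatives are identified with [dloss] for [r >= 1], hence near infinity, which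
     suffices for the limit. *)
  apply: row_cvg => p; rewrite mxE; apply: cvg_trans (dloss_cvg (ebasis d p.+1)).
  apply: near_eq_cvg; near=> r; have r1 : 1 <= r by near: r.
  by rewrite mxE dL.
(* The gradients converge at [theta], so the hypothesis on [G] applies there. *)
have G_theta : G theta = grad_inf.
  rewrite G_lim; last by apply/cvg_ex; exists grad_inf.
  exact: cvg_lim.
have ithG m : (0 < m <= d)%N ->
    ith (G theta) m = @dloss R L d ell a b mu f act_inf step theta (ebasis d m).
  case: m => // m md; rewrite G_theta -[m]/(nat_of_ord (Ordinal md)) ithS mxE.
  by [].
have adm_inf := @admissible_act_inf R.
have idx_range k m : (1 <= k <= L)%N -> (dk ell (k - 1) < m <= dk ell k)%N -> (0 < m <= d)%N.
  by move=> kL; have := leq_dk ell k L; rewrite d_eq; lia.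
split; [|split; [|split; [|split; [|split]]]].
- move=> r r1; exact: (loss_C1 mu_fin mf f2_fin C _ (adm r r1) (derivable_act r r1)
    (continuous_D r r1)).
- move=> r k i j r1 kL ik jk; rewrite dL// rhsW_r_path//.
  exact: (dloss_weight mu_fin mf f2_fin C _ _ theta (adm r r1) d_eq).
- move=> r k i r1 kL ik; rewrite dL// rhsB_r_path//.
  exact: (dloss_bias mu_fin mf f2_fin C _ _ theta (adm r r1) d_eq).
- apply: limf_esup_eq0 => [r|]; first by rewrite addr_ge0// enorm_ge0.
  rewrite -[X in _ --> X](addr0 0); apply: cvgD; last first.
    by rewrite G_theta; exact: enorm_cvg0.
  rewrite -(normr0 R) -(subrr (loss ell L mu a b act_inf f theta)).
  by apply: cvg_norm; apply: cvgB => //; exact: cvg_cst.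
- move=> k i j kL ik jk; rewrite ithG; last first.
    by apply: (idx_range k) => //; apply: weight_index_block => //; case/andP: kL.
  rewrite rhsW_inf_path//.
  exact: (dloss_weight mu_fin mf f2_fin 1 _ _ theta adm_inf d_eq).
- move=> k i kL ik; rewrite ithG; last first.
    by apply: (idx_range k) => //; apply: bias_index_block => //; case/andP: kL.
  rewrite rhsB_inf_path//.
  exact: (dloss_bias mu_fin mf f2_fin 1 _ _ theta adm_inf d_eq).
Unshelve. all: by end_near. Qed.
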